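(* Let $k \geq 2$ be an integer, let $G$ be a $2k$-edge-connected, locally finite graph, and let $A$ be a finite set of vertices of $G$ such that each connected component of $G-A$ is boundary-linked. Then there is a set of vertices $X \subseteq V(G)\setminus A$ containing at most one vertex from each component of $G-A$ such that $G$ contains an immersion, on $A \cup X$, of a finite, $3$-edge-connected multigraph $H$ with vertex set $A\cup X$ with the following properties: (i) $d_H(x) = 3$ for all $x \in X$; (ii) $\lambda_H(a,b) \geq 2k$ for all distinct $a,b \in A$; (iii) every edge of $G$ between two vertices of $A$ is also an edge of $H$ (i.e. it is an edge of $H$ whose corresponding path in the immersion is that edge itself).
   Context: For a set of vertices $B$, its boundary is the set of edges of $G$ with exactly one endvertex in $B$. Two rays of $G$ are equivalent if there are infinitely many pairwise vertex-disjoint paths between them in $G$. A set of vertices $B$ is boundary-linked if $G[B]$ together with the boundary edges of $B$ contains a collection of pairwise edge-disjoint, pairwise equivalent rays $R_1,R_2,\ldots$ such that each boundary edge of $B$ is the first edge of one of the $R_i$. If $H$ is a multigraph with vertices $x_1,\ldots,x_n$, an immersion of $H$ in $G$ on $\{y_1,\ldots,y_n\}$ is a subgraph of $G$ consisting of $n$ distinct distinguished vertices $y_1,\ldots,y_n$ (with $y_i$ corresponding to $x_i$) and a collection of pairwise edge-disjoint paths in $G$ such that for each edge $x_ix_j$ of $H$ (counted with multiplicity) there is a corresponding path in the collection from $y_i$ to $y_j$. $d_H(x)$ denotes the degree of $x$ in $H$ and $\lambda_H(a,b)$ the maximum number of pairwise edge-disjoint $a$–$b$ paths in $H$. *)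

(* Defs.v *)
(* G is a simple graph given by a symmetric irreflexive
   adjacency relation [adj] on an arbitrary (possibly infinite) vertex type V. *)
From Stdlib Require Export List.
Export ListNotations.
Set Implicit Arguments.

Fixpoint gwalk {V : Type} (adj : V -> V -> Prop) (p : list V) : Prop :=
  match p with
  | a :: ((b :: _) as q) => adj a b /\ gwalk adj q
  | _ => True
  end.

Definition gpath {V : Type} (adj : V -> V -> Prop) (p : list V) (u v : V) : Prop :=
  p <> [] /\ NoDup p /\ gwalk adj p /\ hd_error p = Some u /\ last p u = v.

Fixpoint pedge {V : Type} (p : list V) (u v : V) : Prop :=
  match p with
  | a :: ((b :: _) as q) => (a = u /\ b = v \/ a = v /\ b = u) \/ pedge q u v
  | _ => False
  end.

Definition edge_disjoint {V : Type} (p q : list V) : Prop :=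
  forall u v, pedge p u v -> ~ pedge q u v.

Definition avoids {V : Type} (F : list (V * V)) (u v : V) : Prop :=
  ~ In (u, v) F /\ ~ In (v, u) F.

Definition edge_connected {V : Type} (adj : V -> V -> Prop) (l : nat) : Prop :=
  forall F : list (V * V), length F < l ->
    forall u v : V, exists p, gpath (fun a b => adj a b /\ avoids F a b) p u v.

Definition locally_finite {V : Type} (adj : V -> V -> Prop) : Prop :=
  forall v : V, exists l : list V, forall w, adj v w -> In w l.

(* vertex set of the component of G - A containing v (empty if v in A) *)
Definition comp {V : Type} (adj : V -> V -> Prop) (A : list V) (v : V) : V -> Prop :=
  fun w => ~ In v A /\ ~ In w A /\
    exists p, gpath (fun a b => adj a b /\ ~ In a A /\ ~ In b A) p v w.

Definition ray {V : Type} (adj : V -> V -> Prop) (r : nat -> V) : Prop :=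
  (forall n m, r n = r m -> n = m) /\ (forall n, adj (r n) (r (S n))).

Definition redge {V : Type} (r : nat -> V) (n : nat) (u v : V) : Prop :=
  (r n = u /\ r (S n) = v) \/ (r n = v /\ r (S n) = u).

Definition rays_edge_disjoint {V : Type} (r s : nat -> V) : Prop :=
  forall n m u v, redge r n u v -> ~ redge s m u v.

Definition equiv_rays {V : Type} (adj : V -> V -> Prop) (r s : nat -> V) : Prop :=
  exists P : nat -> list V,
    (forall i, exists n m, gpath adj (P i) (r n) (s m)) /\
    (forall i j, i <> j -> forall x, In x (P i) -> ~ In x (P j)).

Definition boundary_edge {V : Type} (adj : V -> V -> Prop) (B : V -> Prop) (u v : V) : Prop :=
  adj u v /\ B u /\ ~ B v.

(* G[B] together with the boundary edges of B contains pairwise edge-disjoint,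
   pairwise equivalent rays R_i such that every boundary edge is the first
   edge of one of the R_i.  A ray lies in G[B] + boundary edges iff each of
   its edges has at least one endvertex in B. *)
Definition boundary_linked {V : Type} (adj : V -> V -> Prop) (B : V -> Prop) : Prop :=
  exists (I : Type) (R : I -> nat -> V),
    (forall i, ray adj (R i) /\ forall n, B (R i n) \/ B (R i (S n))) /\
    (forall i j, i <> j -> rays_edge_disjoint (R i) (R j)) /\
    (forall i j, i <> j -> equiv_rays adj (R i) (R j)) /\
    (forall u v, boundary_edge adj B u v -> exists i, redge (R i) 0 u v).

(* Edges of H are the entries of hE (so parallel edges = repeated entries),
   identified by their index in hE. *)

Definition hpath {V : Type} (hE : list (V * V)) (ok : nat -> Prop)
    (vs : list V) (es : list nat) (a b : V) : Prop :=
  length vs = S (length es) /\ NoDup vs /\ hd_error vs = Some a /\ last vs a = b /\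
  forall i, i < length es ->
    ok (nth i es 0) /\ nth i es 0 < length hE /\
    ((fst (nth (nth i es 0) hE (a, a)) = nth i vs a /\
      snd (nth (nth i es 0) hE (a, a)) = nth (S i) vs a) \/
     (snd (nth (nth i es 0) hE (a, a)) = nth i vs a /\
      fst (nth (nth i es 0) hE (a, a)) = nth (S i) vs a)).

Definition h_edge_connected {V : Type} (hE : list (V * V)) (VH : list V) (l : nat) : Prop :=
  forall F : list nat, length F < l ->
    forall u v, In u VH -> In v VH ->
      exists vs es, hpath hE (fun i => ~ In i F) vs es u v.

Definition lambda_ge {V : Type} (hE : list (V * V)) (a b : V) (l : nat) : Prop :=
  exists Ps : list (list V * list nat),
    length Ps = l /\
    Forall (fun P => hpath hE (fun _ => True) (fst P) (snd P) a b) Ps /\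
    ForallOrdPairs (fun P Q => forall i, In i (snd P) -> ~ In i (snd Q)) Ps.

(* degree of x in the loopless multigraph with edge list hE is n *)
Inductive degH {V : Type} (x : V) : list (V * V) -> nat -> Prop :=
| degH_nil : degH x [] 0
| degH_in : forall u v l n, (u = x \/ v = x) -> degH x l n -> degH x ((u, v) :: l) (S n)
| degH_out : forall u v l n, u <> x -> v <> x -> degH x l n -> degH x ((u, v) :: l) n.

(* An immersion (on the identity branch map) of the multigraph whose edge list
   is map fst imm: each edge (u,v) comes with a u--v path of G, and the paths
   are pairwise edge-disjoint. *)
Definition immersion {V : Type} (adj : V -> V -> Prop) (imm : list ((V * V) * list V)) : Prop :=
  Forall (fun e => gpath adj (snd e) (fst (fst e)) (snd (fst e))) imm /\
  ForallOrdPairs (fun e f => edge_disjoint (snd e) (snd f)) imm.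

(* Main.v *)
(* Contract every component of G - A to a vertex s; the cuts separating A still have at least
   2k edges. The edges at s are removed two at a time by lifting (replacing as, sb by ab) until
   at most three are left; three edges become a vertex of X. A lifting is realized in G through
   two of the given rays, which requires a path between them that is edge-disjoint from the
   other rays. Such a path exists across every bipartition of the remaining rays, because they
   are equivalent, but one cannot choose the pair. So one needs that every connected graph on
   the edges at s contains a pair whose lifting keeps the cuts that separate A. As 2k is even,
   uncrossing dangerous sets proves this with one exception: A is covered by two dangerous sets
   X, Y, exactly one edge f at s goes to X ∩ Y, and as many go to X - Y as to Y - X. In that
   case all pairs between X - Y and Y - X can be lifted, in any order, until three edges are left,
   and some such matching can be realized: when no path joins the two sides directly, paths from
   both sides reach the ray of f, and the first of them on this ray becomes the new vertex.
   Finally X is independent in H with all degrees 3, so 3-edge-connectivity follows from the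
   cuts, and the edge-disjoint paths come from Menger's theorem. *)
Require Import Defs.
From Stdlib Require Import Classical ClassicalEpsilon Lia Arith ZArith Permutation Bool Relations.

Set Implicit Arguments.

(** The obstacle is the lack of choice. Of infinitely many disjoint paths between two rays one
    avoids any finite set, hence everything built so far. Trimmed to run from its last vertex on a
    ray of one side to the next vertex on a ray of the other side, it meets the remaining rays only
    in its ends, but which two rays these are cannot be prescribed.

    A set blocks a pair if its degree is 2k or 2k + 1. Two blocking sets thus exceed twice the
    minimum 2k by at most 2, and an edge from s to their intersection costs exactly 2 in the
    posimodular inequality. Hence the single edge f, and hence the tightness of all inequalities in
    the exceptional case. There, lifting two edges ending in X, or two ending in Y, would leave a
    cut of at most 2k - 1 edges, so f can be paired with nothing. The available links may form a
    star centred at f, and then no single lifting is possible and three edges have to be treated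
    together.

    Only cuts separating A are ever controlled, so vertices created for components already treated
    impose no further condition. *)

Definition dec (P : Prop) : bool := if excluded_middle_informative P then true else false.

Lemma decT (P : Prop) : dec P = true <-> P.
Proof. unfold dec. destruct (excluded_middle_informative P); intuition discriminate. Qed.

Lemma decF (P : Prop) : dec P = false <-> ~ P.
Proof. unfold dec. destruct (excluded_middle_informative P); intuition discriminate. Qed.

(** * Cuts and liftings *)

Definition count {T : Type} (p : T -> bool) (l : list T) : nat := length (filter p l).

Lemma count_cons {T} (p : T -> bool) x l :
  count p (x :: l) = (if p x then 1 else 0) + count p l.
Proof. unfold count. simpl. destruct (p x); reflexivity. Qed.

Lemma count_app {T} (p : T -> bool) l m : count p (l ++ m) = count p l + count p m.
Proof. unfold count. rewrite filter_app, length_app. reflexivity. Qed.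

Lemma count_perm {T} (p : T -> bool) l m : Permutation l m -> count p l = count p m.
Proof.
  induction 1; repeat rewrite count_cons; try lia.
Qed.

Lemma count_ext_in {T} (p q : T -> bool) l :
  (forall x, In x l -> p x = q x) -> count p l = count q l.
Proof. intros H. unfold count. f_equal. apply filter_ext_in. exact H. Qed.

Lemma count_le_in {T} (p q : T -> bool) l :
  (forall x, In x l -> p x = true -> q x = true) -> count p l <= count q l.
Proof.
  induction l as [|x l IH]; intros H; [auto|]. rewrite !count_cons.
  assert (count p l <= count q l) by (apply IH; intros; apply H; simpl; auto).
  destruct (p x) eqn:E; [rewrite (H x (or_introl eq_refl) E)|]; destruct (q x); lia.
Qed.

Lemma count_lt_in {T} (p q : T -> bool) l :
  (forall x, In x l -> p x = true -> q x = true) ->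
  (exists x, In x l /\ p x = false /\ q x = true) -> S (count p l) <= count q l.
Proof.
  induction l as [|x l IH]; intros H (y & Hy & Hp & Hq); [destruct Hy|]. rewrite !count_cons.
  assert (Hl : forall x, In x l -> p x = true -> q x = true) by (intros; apply H; simpl; auto).
  destruct Hy as [->|Hy].
  - rewrite Hp, Hq. apply count_le_in in Hl. lia.
  - assert (S (count p l) <= count q l) by (apply IH; eauto).
    destruct (p x) eqn:E; [rewrite (H x (or_introl eq_refl) E)|]; destruct (q x); lia.
Qed.

Lemma count_negb {T} (p : T -> bool) l : count (fun x => negb (p x)) l + count p l = length l.
Proof. induction l as [|x l IH]; [auto|]. rewrite !count_cons. simpl. destruct (p x); simpl; lia. Qed.

Lemma count_pos {T} (p : T -> bool) l x : In x l -> p x = true -> 1 <= count p l.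
Proof.
  intros Hx Hp. unfold count.
  assert (H : In x (filter p l)) by (apply filter_In; auto).
  destruct (filter p l); [destruct H | simpl; lia].
Qed.

Lemma count_le_length {T} (p : T -> bool) l : count p l <= length l.
Proof. apply filter_length_le. Qed.

Lemma count_all {T} (p : T -> bool) l : (forall x, In x l -> p x = true) -> count p l = length l.
Proof.
  induction l as [|x l IH]; intros H; [auto|]. rewrite count_cons, H, IH; simpl; auto.
  intros; apply H; simpl; auto.
Qed.

Definition setU {V} (X Y : V -> bool) v := X v || Y v.
Definition setI {V} (X Y : V -> bool) v := X v && Y v.
Definition setD {V} (X Y : V -> bool) v := X v && negb (Y v).
Definition setC {V} (X : V -> bool) v := negb (X v).

Definition cut {V} (E : list (V * V)) (S : V -> bool) : nat :=
  count (fun e => xorb (S (fst e)) (S (snd e))) E.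

(** Vertices outside [A] may lie on either side, so a lower bound on [cut] over all separating sets
    is the hypothesis of Menger's theorem for any two vertices of [A]. *)
Definition separates {V} (A : list V) (S : V -> bool) : Prop :=
  (exists a, In a A /\ S a = true) /\ (exists b, In b A /\ S b = false).

(* [E] is a multigraph together with one further vertex s, given by the list [D] of the
   edges at s, [t i] being the end of [i] other than s.  [degree E t D S] is the
   number of edges leaving [S] when s is outside [S]. *)
Definition degree {V I} (E : list (V * V)) (t : I -> V) (D : list I) (S : V -> bool) : nat :=
  cut E S + count (fun i => S (t i)) D.

Definition linked {V I} (A : list V) (c : nat) E (t : I -> V) (D : list I) : Prop :=
  forall S, separates A S -> c <= degree E t D S.

Lemma cut_cons {V} (u v : V) E S :
  cut ((u, v) :: E) S = (if xorb (S u) (S v) then 1 else 0) + cut E S.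
Proof. unfold cut. rewrite count_cons. reflexivity. Qed.

Lemma cut_app {V} (E F : list (V * V)) S : cut (E ++ F) S = cut E S + cut F S.
Proof. apply count_app. Qed.

Lemma separates_C {V} (A : list V) S : separates A S -> separates A (setC S).
Proof.
  intros ((a & Ha & Sa) & (b & Hb & Sb)); split; [exists b | exists a];
    unfold setC; rewrite ?Sa, ?Sb; auto.
Qed.

Section Degree.
Context {V I : Type}.
Implicit Types (E : list (V * V)) (X Y : V -> bool) (t : I -> V) (D : list I).

Lemma cut_C E X : cut E (setC X) = cut E X.
Proof. unfold cut, setC. apply count_ext_in. intros [u v] _. simpl. destruct (X u), (X v); reflexivity. Qed.

Ltac bools := unfold setU, setI, setD, setC in *;
  repeat match goal with |- context [?X ?u] =>
    is_var X; match type of (X u) with bool => destruct (X u) end end;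
  simpl; lia.

Lemma cut_submodular E X Y : cut E (setI X Y) + cut E (setU X Y) <= cut E X + cut E Y.
Proof.
  induction E as [|[u v] E IH]; [simpl; auto|]. rewrite !cut_cons.
  revert IH. generalize (cut E X) (cut E Y) (cut E (setI X Y)) (cut E (setU X Y)).
  intros. bools.
Qed.

Lemma cut_posimodular E X Y : cut E (setD X Y) + cut E (setD Y X) <= cut E X + cut E Y.
Proof.
  induction E as [|[u v] E IH]; [simpl; auto|]. rewrite !cut_cons.
  revert IH. generalize (cut E X) (cut E Y) (cut E (setD X Y)) (cut E (setD Y X)).
  intros. bools.
Qed.

Lemma cut_parity E X Y : exists e, cut E X + 2 * e = cut E (setI X Y) + cut E (setD X Y).
Proof.
  induction E as [|[u v] E [e IH]]; [exists 0; auto|]. rewrite !cut_cons.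
  (* [e] counts the edges inside [X] with exactly one end in [Y]. *)
  exists (e + if xorb (X u) (X v) then 0 else
          if X u then if xorb (Y u) (Y v) then 1 else 0 else 0).
  revert IH. generalize (cut E X) (cut E (setI X Y)) (cut E (setD X Y)). intros. bools.
Qed.

Lemma count_modular t D X Y :
  count (fun i => setI X Y (t i)) D + count (fun i => setU X Y (t i)) D =
  count (fun i => X (t i)) D + count (fun i => Y (t i)) D.
Proof.
  induction D as [|i D IH]; [auto|]. rewrite !count_cons. revert IH.
  generalize (count (fun i => setI X Y (t i)) D) (count (fun i => setU X Y (t i)) D)
    (count (fun i => X (t i)) D) (count (fun i => Y (t i)) D). intros. bools.
Qed.

Lemma count_split t D X Y :
  count (fun i => setI X Y (t i)) D + count (fun i => setD X Y (t i)) D = count (fun i => X (t i)) D.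
Proof.
  induction D as [|i D IH]; [auto|]. rewrite !count_cons. revert IH.
  generalize (count (fun i => setI X Y (t i)) D) (count (fun i => setD X Y (t i)) D)
    (count (fun i => X (t i)) D). intros. bools.
Qed.

Lemma count_I_sym t D X Y :
  count (fun i => setI X Y (t i)) D = count (fun i => setI Y X (t i)) D.
Proof. apply count_ext_in. intros. apply andb_comm. Qed.

Lemma degree_submodular E t D X Y :
  degree E t D (setI X Y) + degree E t D (setU X Y) <= degree E t D X + degree E t D Y.
Proof.
  unfold degree. pose proof (cut_submodular E X Y). pose proof (count_modular t D X Y). lia.
Qed.

(** As s lies outside both sets, an edge from s to [X ∩ Y] is counted for [X] and for [Y] but for
    neither difference. *)
Lemma degree_posimodular E t D X Y :
  degree E t D (setD X Y) + degree E t D (setD Y X) + 2 * count (fun i => setI X Y (t i)) D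
  <= degree E t D X + degree E t D Y.
Proof.
  unfold degree. pose proof (cut_posimodular E X Y).
  pose proof (count_split t D X Y). pose proof (count_split t D Y X).
  pose proof (count_I_sym t D X Y). lia.
Qed.

Lemma degree_parity E t D X Y :
  exists e, degree E t D X + 2 * e = degree E t D (setI X Y) + degree E t D (setD X Y).
Proof.
  destruct (cut_parity E X Y) as [e He]. exists e. unfold degree.
  pose proof (count_split t D X Y). lia.
Qed.

(** The vertex s is outside a set and outside its complement alike, so complementing exchanges the
    edges of s that end in [X] for the other ones. *)
Lemma degree_C E t D X :
  degree E t D (setC X) + 2 * count (fun i => X (t i)) D = degree E t D X + length D.
Proof.
  unfold degree. rewrite cut_C. pose proof (count_negb (fun i => X (t i)) D).
  unfold setC. lia.
Qed.

Lemma degree_perm E t D D' X : Permutation D D' -> degree E t D X = degree E t D' X.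
Proof. intros H. unfold degree. rewrite (count_perm _ H). reflexivity. Qed.

Lemma linked_perm A c E t D D' : Permutation D D' -> linked A c E t D -> linked A c E t D'.
Proof. intros HP H S HS. rewrite <- (degree_perm E t S HP). auto. Qed.

Lemma linked_cut_ext A c E E' t D :
  (forall S, cut E S = cut E' S) -> linked A c E t D -> linked A c E' t D.
Proof. intros HP H S HS. unfold degree. rewrite <- HP. apply H, HS. Qed.

Lemma degree_lift E t D p q X :
  degree ((t p, t q) :: E) t D X + (if X (t p) && X (t q) then 2 else 0) =
  degree E t (p :: q :: D) X.
Proof. unfold degree. rewrite cut_cons, !count_cons. destruct (X (t p)), (X (t q)); simpl; lia. Qed.

(** Lifting two edges that end in [X] lowers its degree by 2, which is fatal exactly for these
    sets. *)
Definition dangerous (A : list V) c E t D X := separates A X /\ degree E t D X <= S c.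

Lemma not_liftable A c E t D p q :
  linked A c E t (p :: q :: D) -> ~ linked A c ((t p, t q) :: E) t D ->
  exists X, dangerous A c E t (p :: q :: D) X /\ X (t p) = true /\ X (t q) = true.
Proof.
  intros HL HN. apply not_all_ex_not in HN. destruct HN as [X HX].
  apply imply_to_and in HX. destruct HX as [HS HX]. exists X.
  pose proof (degree_lift E t D p q X) as HD. pose proof (HL X HS).
  destruct (X (t p)), (X (t q)); simpl in HD; try lia.
  repeat split; auto; try apply HS. lia.
Qed.

(** * Uncrossing dangerous sets *)

Section Splitting.
Context (A : list V) (k : nat) (E : list (V * V)) (t : I -> V) (D : list I).
Context (HL : linked A (2 * k) E t D) (HDA : forall i, In i D -> In (t i) A).
Let d := degree E t D.
Let n X := count (fun i => X (t i)) D.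
Let dang := dangerous A (2 * k) E t D.

(** Union, intersection and both differences separate [A]. As [f] ends in [X ∩ Y], posimodularity
    forces degree 2k + 1 for [X] and [Y] and 2k for the differences; submodularity then leaves one
    case, which parity excludes. *)
Lemma crossing_dangerous X Y f g :
  dang X -> dang Y -> In f D -> In g D ->
  X (t f) = true -> X (t g) = false -> Y (t f) = true -> Y (t g) = true ->
  n Y <= n X -> (exists a, In a A /\ X a = false /\ Y a = false) ->
  dang (setU X Y) /\ n X < n (setU X Y).
Proof.
  intros [SX dX] [SY dY] Hf Hg Xf Xg Yf Yg Hn (w & Aw & Xw & Yw). fold d in dX, dY.
  assert (HU : separates A (setU X Y)).
  { split; [exists (t f) | exists w]; unfold setU; rewrite ?Xf, ?Xw, ?Yw; auto. }
  assert (HI : separates A (setI X Y)).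
  { split; [exists (t f) | exists w]; unfold setI; rewrite ?Xf, ?Yf, ?Xw, ?Yw; auto. }
  assert (HDYX : separates A (setD Y X)).
  { split; [exists (t g) | exists w]; unfold setD; rewrite ?Yg, ?Xg, ?Xw, ?Yw; auto. }
  (* Otherwise every edge of s ending in [X] also ends in [Y], and [g] makes the count strict,
     against [n Y <= n X]. *)
  assert (HDXY : separates A (setD X Y)).
  { split; [|exists w; unfold setD; rewrite ?Xw; auto].
    apply NNPP. intros HN. assert (n X < n Y); [|lia]. unfold n. apply count_lt_in.
    - intros i Hi Hx. apply not_false_is_true. intros Hy. apply HN. exists (t i).
      unfold setD. rewrite Hx, Hy. auto.
    - exists g. auto. }
  split; [split; auto|].
  - fold d. pose proof (degree_submodular E t D X Y) as H1. fold d in H1.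
    pose proof (degree_posimodular E t D X Y) as H2. fold d in H2.
    destruct (degree_parity E t D X Y) as [e H3]. fold d in H3.
    (* If the union were not dangerous, then [d X = 2k+1] and [d (X ∩ Y) = d (X - Y) = 2k],
       against parity. *)
    pose proof (HL HU) as HU'. pose proof (HL HI) as HI'. pose proof (HL HDYX) as HDYX'.
    pose proof (HL HDXY) as HDXY'. fold d in HU', HI', HDYX', HDXY'.
    assert (1 <= count (fun i => setI X Y (t i)) D).
    { apply (@count_pos _ _ _ f); auto. unfold setI. rewrite Xf, Yf. reflexivity. }
    lia.
  - unfold n. apply count_lt_in.
    + intros i _ Hx. unfold setU. rewrite Hx. reflexivity.
    + exists g. unfold setU. rewrite Xg, Yg. auto.
Qed.

(** Separating sets that cover [A] have separating differences, since a vertex of [A] missed by one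
    set lies in the other. So posimodularity is tight, with [f] alone in the intersection. The same
    inequality for [Y] and the complement of [Y - X] gives the bound on the edges to [Y - X]. *)
Lemma covering_dangerous_D X Y f :
  dang X -> dang Y -> In f D -> X (t f) = true -> Y (t f) = true ->
  (forall a, In a A -> X a = true \/ Y a = true) ->
  n (setI X Y) = 1 /\ d (setD Y X) = 2 * k /\ 2 * n (setD Y X) + 1 <= length D.
Proof.
  intros [SX dX] [SY dY] Hf Xf Yf HA. fold d in dX, dY.
  assert (HS : forall Z W, separates A Z -> separates A W ->
    (forall a, In a A -> Z a = true \/ W a = true) -> separates A (setD Z W)).
  { intros Z W ((a & Aa & Za) & _) ((c & Ac & Wc) & (b & Ab & Wb)) H. split.
    - exists b. destruct (H b Ab) as [Zb|Zb]; [|congruence]. unfold setD. rewrite Zb, Wb. auto.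
    - exists c. unfold setD. rewrite Wc. rewrite andb_false_r. auto. }
  pose proof (HS X Y SX SY HA) as SXY.
  pose proof (HS Y X SY SX (fun a Ha => proj1 (or_comm _ _) (HA a Ha))) as SYX.
  pose proof (HL SXY) as LXY. pose proof (HL SYX) as LYX. fold d in LXY, LYX.
  assert (N1 : 1 <= n (setI X Y)).
  { apply (@count_pos _ _ _ f); auto. unfold setI. rewrite Xf, Yf. reflexivity. }
  pose proof (degree_posimodular E t D X Y) as H2. fold d in H2. fold (n (setI X Y)) in H2.
  assert (n (setI X Y) = 1) by lia. assert (d (setD Y X) = 2 * k) by lia.
  repeat split; auto.
  (* [Z] is [X] enlarged by all vertices other than s outside [X ∪ Y]. *)
  set (Z := setC (setD Y X)).
  pose proof (degree_C E t D (setD Y X)) as HC. fold d in HC. fold Z in HC. fold (n (setD Y X)) in HC.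
  pose proof (separates_C SYX) as SZ. fold Z in SZ.
  assert (HZY : forall a, In a A -> Z a = true \/ Y a = true).
  { intros a Ha. unfold Z, setC, setD. destruct (HA a Ha) as [->| ->]; simpl; auto.
    rewrite andb_false_r. auto. }
  pose proof (HS Z Y SZ SY HZY) as SZY.
  pose proof (HS Y Z SY SZ (fun a Ha => proj1 (or_comm _ _) (HZY a Ha))) as SYZ.
  pose proof (HL SZY) as LZY. pose proof (HL SYZ) as LYZ. fold d in LZY, LYZ.
  pose proof (degree_posimodular E t D Z Y) as H3. fold d in H3. fold (n (setI Z Y)) in H3.
  assert (1 <= n (setI Z Y)).
  { apply (@count_pos _ _ _ f); auto. unfold setI, Z, setC, setD. rewrite Xf, Yf. reflexivity. }
  lia.
Qed.
End Splitting.
End Degree.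

Lemma perm_two {T} (l : list T) p q :
  In p l -> In q l -> p <> q -> exists l', Permutation l (p :: q :: l').
Proof.
  intros Hp Hq Hn. destruct (in_split _ _ Hp) as (l1 & l2 & ->).
  assert (H : In q (l1 ++ l2)).
  { apply in_app_iff in Hq. apply in_app_iff. destruct Hq as [|[|]]; auto. congruence. }
  destruct (in_split _ _ H) as (m1 & m2 & Hm). exists (m1 ++ m2).
  rewrite <- Permutation_middle. apply perm_skip. rewrite Hm. symmetry. apply Permutation_middle.
Qed.

Lemma filter_negb_perm {T} (p : T -> bool) l :
  Permutation l (filter p l ++ filter (fun x => negb (p x)) l).
Proof.
  induction l as [|x l IH]; simpl; [auto|]. destruct (p x); simpl.
  - apply perm_skip, IH.
  - rewrite <- Permutation_middle. apply perm_skip, IH.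
Qed.

(* Equivalently, [T] is a connected relation on [D], orientation aside. *)
Definition meets_cuts {I} (D : list I) (T : I -> I -> Prop) : Prop :=
  forall P : I -> bool, (exists i, In i D /\ P i = true) -> (exists i, In i D /\ P i = false) ->
    exists p q, In p D /\ In q D /\ P p = true /\ P q = false /\ T p q.

(* The obstruction to lifting a pair of a connected relation: two dangerous sets that cover [A]
   and have only the edge [f] of s in common. *)
Definition obstructed {V I} (A : list V) c E (t : I -> V) f U W : Prop :=
  exists X Y, dangerous A c E t (f :: U ++ W) X /\ dangerous A c E t (f :: U ++ W) Y /\
    (forall a, In a A -> X a = true \/ Y a = true) /\
    (X (t f) = true /\ Y (t f) = true) /\
    (forall u, In u U -> X (t u) = true /\ Y (t u) = false) /\
    (forall w, In w W -> X (t w) = false /\ Y (t w) = true).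

Lemma dangerous_perm {V I} (A : list V) c E (t : I -> V) D D' X :
  Permutation D D' -> dangerous A c E t D X -> dangerous A c E t D' X.
Proof. intros H [HS Hd]. split; auto. rewrite <- (degree_perm E t X H). auto. Qed.

(** By [covering_dangerous_D] each difference receives at most half of the edges other than [f].
    These edges all go to the differences, so both bounds are attained. *)
Lemma covering_obstructed {V I} (A : list V) k E (t : I -> V) D X Y f :
  linked A (2 * k) E t D -> (forall i, In i D -> In (t i) A) ->
  dangerous A (2 * k) E t D X -> dangerous A (2 * k) E t D Y ->
  In f D -> X (t f) = true -> Y (t f) = true ->
  (forall a, In a A -> X a = true \/ Y a = true) ->
  exists U W, Permutation D (f :: U ++ W) /\ length U = length W /\
    obstructed A (2 * k) E t f U W.
Proof.
  intros HL HDA dX dY Hf Xf Yf HA.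
  destruct (covering_dangerous_D _ HL f dX dY Hf Xf Yf HA) as (N1 & _ & N2).
  destruct (covering_dangerous_D _ HL f dY dX Hf Yf Xf (fun a Ha => proj1 (or_comm _ _) (HA a Ha)))
    as (_ & _ & N3).
  set (U := filter (fun i => negb (Y (t i))) D).
  set (W := filter (fun i => negb (X (t i))) (filter (fun i => Y (t i)) D)).
  assert (HI : filter (fun i => X (t i)) (filter (fun i => Y (t i)) D) = [f]).
  { assert (Hin : In f (filter (fun i => X (t i)) (filter (fun i => Y (t i)) D)))
      by (repeat (apply filter_In; split; auto)).
    assert (Hl : length (filter (fun i => X (t i)) (filter (fun i => Y (t i)) D)) = 1).
    { rewrite <- N1. unfold count, setI. clear. induction D as [|i D IH]; simpl; auto.
      destruct (Y (t i)), (X (t i)) eqn:E; simpl; rewrite ?E; simpl; auto. }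
    revert Hin Hl.
    generalize (filter (fun i => X (t i)) (filter (fun i => Y (t i)) D)).
    intros [|g [|h l]] Hin Hl; try discriminate Hl. destruct Hin as [->|[]]; reflexivity. }
  assert (HP : Permutation D (f :: U ++ W)).
  { rewrite (filter_negb_perm (fun i => Y (t i)) D) at 1.
    rewrite (filter_negb_perm (fun i => X (t i)) (filter (fun i => Y (t i)) D)).
    rewrite HI. simpl. apply perm_skip. apply Permutation_app_comm. }
  assert (HU : forall u, In u U -> X (t u) = true /\ Y (t u) = false).
  { intros u Hu. apply filter_In in Hu. destruct Hu as [Hu Yu]. apply negb_true_iff in Yu.
    destruct (HA _ (HDA _ Hu)); [auto|congruence]. }
  assert (HW : forall w, In w W -> X (t w) = false /\ Y (t w) = true).
  { intros w Hw. apply filter_In in Hw. destruct Hw as [Hw Xw]. apply negb_true_iff in Xw.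
    apply filter_In in Hw. tauto. }
  exists U, W. split; [auto|]. split.
  - rewrite (count_perm _ HP), count_cons, count_app in N2.
    rewrite (count_perm _ HP), count_cons, count_app in N3.
    rewrite (Permutation_length HP) in N2, N3. simpl in N2, N3. rewrite length_app in N2, N3.
    rewrite (@count_all _ _ W) in N2
      by (intros w Hw; apply HW in Hw; destruct Hw as [Hx Hy]; unfold setD; rewrite Hx, Hy; auto).
    rewrite (@count_all _ _ U) in N3
      by (intros w Hw; apply HU in Hw; destruct Hw as [Hx Hy]; unfold setD; rewrite Hx, Hy; auto).
    lia.
  - exists X, Y. split; [|split]; auto; apply (dangerous_perm HP); auto.
Qed.

(** If no pair of [T] can be lifted, each lies in a dangerous set. Given a dangerous set, some pair
    of [T] leaves it, and the dangerous set of this pair receives more edges of s, or the union of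
    the two is dangerous and does, or the two cover [A]. The growth can only stop in the last
    way. *)
Lemma lift_or_obstructed {V I} (A : list V) k E (t : I -> V) D T :
  linked A (2 * k) E t D -> (forall i, In i D -> In (t i) A) -> 4 <= length D -> NoDup D ->
  meets_cuts D T ->
  (exists p q D', T p q /\ Permutation D (p :: q :: D') /\
     linked A (2 * k) ((t p, t q) :: E) t D') \/
  (exists f U W, Permutation D (f :: U ++ W) /\ length U = length W /\
     obstructed A (2 * k) E t f U W).
Proof.
  intros HL HDA H4 ND HT.
  apply NNPP. intros HN0. apply not_or_and in HN0. destruct HN0 as [HN HO]. apply HO. clear HO.
  assert (HX : forall p q, In p D -> In q D -> p <> q -> T p q ->
    exists X, dangerous A (2 * k) E t D X /\ X (t p) = true /\ X (t q) = true).
  { intros p q Hp Hq Hpq Tpq. destruct (@perm_two _ D p q Hp Hq Hpq) as [D' HP].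
    destruct (@not_liftable _ _ A (2 * k) E t D' p q) as (X & dX & Xp & Xq).
    - apply (linked_perm HP HL).
    - intros HG. apply HN. exists p, q, D'. auto.
    - exists X. split; auto. apply (dangerous_perm (Permutation_sym HP) dX). }
  (* [m] bounds the number of edges of s that end outside [X]. *)
  assert (HM : forall m X i, dangerous A (2 * k) E t D X -> In i D -> X (t i) = true ->
    length D - count (fun i => X (t i)) D < m -> exists f X Y,
    dangerous A (2 * k) E t D X /\ dangerous A (2 * k) E t D Y /\
    In f D /\ X (t f) = true /\ Y (t f) = true /\
    (forall a, In a A -> X a = true \/ Y a = true)).
  { induction m as [|m IH]; intros X i dX Hi Xi Hm; [lia|].
    destruct (HT (fun i => X (t i))) as (f & g & Hf & Hg & Xf & Xg & Tfg).
    - eauto.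
    - apply NNPP. intros HF.
      (* If all edges of s ended in [X], its complement would have degree at most 2k + 1 - |D| <
         2k. *)
      assert (HAll : count (fun i => X (t i)) D = length D).
      { apply count_all. intros j Hj. apply not_false_is_true. eauto. }
      pose proof (degree_C E t D X) as HC. destruct dX as [SX dX].
      pose proof (HL _ (separates_C SX)). lia.
    - assert (Hfg : f <> g) by congruence.
      destruct (HX f g Hf Hg Hfg Tfg) as (Y & dY & Yf & Yg).
      pose proof (count_le_length (fun i => Y (t i)) D).
      destruct (le_lt_dec (count (fun i => Y (t i)) D) (count (fun i => X (t i)) D)) as [Hle|Hlt].
      2:{ apply (IH Y f); auto. lia. }
      destruct (classic (exists a, In a A /\ X a = false /\ Y a = false)) as [HW|HW].
      + destruct (crossing_dangerous _ HL HDA f g dX dY Hf Hg Xf Xg Yf Yg Hle HW) as [dU Hlt].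
        pose proof (count_le_length (fun i => setU X Y (t i)) D). cbv beta in Hlt.
        apply (IH (setU X Y) f); auto; [unfold setU; rewrite Xf; auto|]. lia.
      + exists f, X, Y. split; [auto|]. split; [auto|]. do 3 (split; [auto|]).
        intros a Ha. destruct (X a) eqn:Xa, (Y a) eqn:Ya; auto. exfalso. eauto. }
  destruct D as [|i [|j D]]; simpl in H4; try lia.
  (* A pair of [T] at the single edge [i] supplies the dangerous set to start from. *)
  destruct (HT (fun x => dec (x = i))) as (p & q & Hp & Hq & Pp & Pq & Tpq).
  { exists i. split; [simpl; auto|]. apply decT. auto. }
  { exists j. split; [simpl; auto|]. apply decF. intros Hji. subst j. inversion ND; subst. simpl in *. tauto. }
  cbv beta in Pp, Pq. rewrite decT in Pp. rewrite decF in Pq. subst p.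
  destruct (HX i q Hp Hq (not_eq_sym Pq) Tpq) as (X & dX & Xi & _).
  destruct (HM _ X i dX Hp Xi (Nat.lt_succ_diag_r _)) as (f & X' & Y & dX' & dY & Hf & Xf & Yf & HA).
  exists f. exact (@covering_obstructed _ _ A k E t _ X' Y f HL HDA dX' dY Hf Xf Yf HA).
Qed.

(** * The obstructed case: lifting a matching *)

Section Obstructed.
Context {V I : Type} (A : list V) (k : nat) (t : I -> V).

(** If [b] were missed, the union of [X] and [Z] would have degree at most 2k + 2 by submodularity
    and receive at least a + 2 of the 2a + 1 edges of s, so its complement would have degree at most
    2k - 1. *)
Lemma obstructed_cover E D X Z u v a :
  linked A (2 * k) E t D -> (forall i, In i D -> In (t i) A) ->
  dangerous A (2 * k) E t D X -> dangerous A (2 * k) E t D Z ->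
  length D = 2 * a + 1 -> a + 1 <= count (fun i => X (t i)) D ->
  In u D -> In v D -> X (t u) = true -> X (t v) = false -> Z (t u) = true -> Z (t v) = true ->
  forall b, In b A -> X b = true \/ Z b = true.
Proof.
  intros HL HDA [SX dX] [SZ dZ] HD HX Hu Hv Xu Xv Zu Zv b Hb.
  destruct (X b) eqn:Xb, (Z b) eqn:Zb; auto. exfalso.
  assert (HU : separates A (setU X Z)).
  { split; [exists (t u) | exists b]; unfold setU; rewrite ?Xu, ?Xb, ?Zb; auto. }
  assert (HI : separates A (setI X Z)).
  { split; [exists (t u) | exists b]; unfold setI; rewrite ?Xu, ?Zu, ?Xb, ?Zb; auto. }
  pose proof (HL _ HI). pose proof (HL _ (separates_C HU)).
  pose proof (degree_submodular E t D X Z). pose proof (degree_C E t D (setU X Z)).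
  assert (S (count (fun i => X (t i)) D) <= count (fun i => setU X Z (t i)) D).
  { apply count_lt_in.
    - intros i _ Hi. unfold setU. rewrite Hi. auto.
    - exists v. unfold setU. rewrite Xv, Zv. auto. }
  lia.
Qed.

(** A dangerous set [Z] blocking [u] and [w] would cover [A] together with [X], and also together
    with [Y]. The edges [u :: U] end outside [Y], hence in [X ∩ Z]; there are at least two, against
    posimodularity. The obstruction survives because [X] and [Y] each contain just one end of the
    new edge and keep their degrees. *)
Lemma obstructed_lift E f u w U W :
  linked A (2 * k) E t (f :: (u :: U) ++ (w :: W)) ->
  (forall i, In i (f :: (u :: U) ++ (w :: W)) -> In (t i) A) ->
  length U = length W -> 1 <= length U ->
  obstructed A (2 * k) E t f (u :: U) (w :: W) ->
  linked A (2 * k) ((t u, t w) :: E) t (f :: U ++ W) /\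
  obstructed A (2 * k) ((t u, t w) :: E) t f U W.
Proof.
  intros HL HDA HUW H1 (X & Y & dX & dY & HA & [Xf Yf] & HU & HW).
  set (D := f :: (u :: U) ++ (w :: W)) in *.
  assert (HP : Permutation D (u :: w :: f :: U ++ W)).
  { unfold D. simpl. rewrite perm_swap. apply perm_skip. rewrite <- Permutation_middle.
    apply perm_swap. }
  assert (Hf : In f D) by (simpl; auto).
  assert (Hu : In u D) by (simpl; auto).
  assert (Hw : In w D) by (simpl; rewrite in_app_iff; simpl; auto).
  assert (HD : length D = 2 * S (length U) + 1) by (simpl; rewrite length_app; simpl; lia).
  assert (NX : S (length U) + 1 <= count (fun i => X (t i)) D).
  { unfold D. rewrite count_cons, Xf, count_app, (@count_all _ _ (u :: U)); [simpl; lia|].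
    intros i Hi. apply HU. auto. }
  assert (NY : S (length U) + 1 <= count (fun i => Y (t i)) D).
  { unfold D. rewrite count_cons, Yf, count_app, (@count_all _ _ (w :: W)); [simpl; lia|].
    intros i Hi. apply HW. auto. }
  destruct (HU u (or_introl eq_refl)) as [Xu Yu]. destruct (HW w (or_introl eq_refl)) as [Xw Yw].
  split.
  - apply NNPP. intros HN.
    destruct (not_liftable (linked_perm HP HL) HN) as (Z & dZ & Zu & Zw).
    apply (dangerous_perm (Permutation_sym HP)) in dZ.
    pose proof (@obstructed_cover E D X Z u w _ HL HDA dX dZ HD NX Hu Hw Xu Xw Zu Zw) as CX.
    pose proof (@obstructed_cover E D Y Z w u _ HL HDA dY dZ HD NY Hw Hu Yw Yu Zw Zu) as CY.
    destruct dX as [SX dX], dZ as [SZ dZ].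
    assert (S1 : separates A (setD X Z)).
    { destruct SZ as [_ (b & Ab & Zb)]. split; [exists b | exists (t u)].
      - unfold setD. destruct (CX b Ab); [|congruence]. rewrite H, Zb. auto.
      - unfold setD. rewrite Zu, andb_false_r. auto. }
    assert (S2 : separates A (setD Z X)).
    { split; [exists (t w) | exists (t u)]; unfold setD; rewrite ?Zw, ?Xw, ?Xu, ?andb_false_r; auto. }
    pose proof (HL _ S1). pose proof (HL _ S2). pose proof (degree_posimodular E t D X Z).
    assert (2 <= count (fun i => setI X Z (t i)) D); [|lia].
    unfold D. rewrite count_cons, count_app, (@count_all _ _ (u :: U)); [simpl; lia|].
    intros i Hi. destruct (HU i Hi) as [Xi Yi]. unfold setI. rewrite Xi.
    destruct (CY (t i)); [|congruence|auto]. apply HDA. simpl in Hi |- *. rewrite in_app_iff. tauto.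
  - exists X, Y.
    assert (HT : forall Z, xorb (Z (t u)) (Z (t w)) = true -> dangerous A (2 * k) E t D Z ->
      dangerous A (2 * k) ((t u, t w) :: E) t (f :: U ++ W) Z).
    { intros Z HZ [SZ dZ]. split; auto. rewrite (degree_perm E t Z HP) in dZ.
      rewrite <- degree_lift in dZ. lia. }
    split; [apply HT; rewrite ?Xu, ?Xw; auto|].
    split; [apply HT; rewrite ?Yu, ?Yw; auto|]. do 2 (split; [auto|]).
    split; intros i Hi; [apply HU | apply HW]; simpl; auto.
Qed.

(** [M] is arbitrary, so the pairs may be dictated by the links found in the graph; [u] and [w] are
    the edges left over beside [f]. *)
Lemma obstructed_matching M : forall E f u w,
  let U := map fst M ++ [u] in let W := map snd M ++ [w] in
  linked A (2 * k) E t (f :: U ++ W) -> (forall i, In i (f :: U ++ W) -> In (t i) A) ->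
  obstructed A (2 * k) E t f U W ->
  linked A (2 * k) (map (fun m => (t (fst m), t (snd m))) M ++ E) t [f; u; w].
Proof.
  induction M as [|[p q] M IH]; intros E f u w; [simpl; auto|]. simpl. intros HL HDA HO.
  destruct (@obstructed_lift E f p q (map fst M ++ [u]) (map snd M ++ [w])) as [HL' HO']; auto.
  { rewrite !length_app, !length_map. auto. }
  { rewrite length_app. simpl. lia. }
  apply IH in HL'; auto.
  - refine (@linked_cut_ext _ _ _ _ _ _ _ _ _ HL'). intros S. rewrite cut_cons, !cut_app, cut_cons. lia.
  - intros i [Hi|Hi]; apply HDA; auto. right. right. rewrite in_app_iff in *. simpl. tauto.
Qed.

Lemma obstructed_perm E f U U' W W' :
  Permutation U U' -> Permutation W W' ->
  obstructed A (2 * k) E t f U W -> obstructed A (2 * k) E t f U' W'.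
Proof.
  intros HU HW (X & Y & dX & dY & HA & Hf & H1 & H2). exists X, Y.
  assert (HP : Permutation (f :: U ++ W) (f :: U' ++ W')).
  { apply perm_skip. apply Permutation_app; auto. }
  split; [apply (dangerous_perm HP dX)|]. split; [apply (dangerous_perm HP dY)|].
  do 2 (split; [auto|]). split; intros i Hi.
  - apply H1. apply (Permutation_in _ (Permutation_sym HU) Hi).
  - apply H2. apply (Permutation_in _ (Permutation_sym HW) Hi).
Qed.
End Obstructed.

(** * Edge-disjoint paths in a finite multigraph *)

Fixpoint zsum (n : nat) (g : nat -> Z) : Z :=
  match n with O => 0%Z | S m => (zsum m g + g m)%Z end.

Lemma zsum_ext n g h : (forall i, i < n -> g i = h i) -> zsum n g = zsum n h.
Proof. induction n as [|n IH]; intros H; simpl; [auto|]. rewrite IH, H; auto. Qed.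

Lemma zsum_add n g h : zsum n (fun i => g i + h i)%Z = (zsum n g + zsum n h)%Z.
Proof. induction n as [|n IH]; simpl; lia. Qed.

Lemma zsum_le n g h : (forall i, i < n -> (g i <= h i)%Z) -> (zsum n g <= zsum n h)%Z.
Proof.
  induction n as [|n IH]; intros H; simpl; [lia|].
  assert (zsum n g <= zsum n h)%Z by (apply IH; intros; apply H; lia).
  specialize (H n). lia.
Qed.

Lemma zsum_single n g i : i < n -> (forall j, j < n -> j <> i -> g j = 0%Z) -> zsum n g = g i.
Proof.
  induction n as [|n IH]; intros Hi H; simpl; [lia|].
  destruct (Nat.eq_dec i n) as [->|Hn].
  - rewrite (@zsum_ext n g (fun _ => 0%Z)) by (intros; apply H; lia).
    assert (zsum n (fun _ => 0%Z) = 0%Z) by (clear; induction n; simpl; lia). lia.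
  - rewrite IH by (auto; lia). rewrite (H n); lia.
Qed.

Section Flow.
Context {V : Type} (E : list (V * V)) (d0 : V * V).
Let U i := fst (nth i E d0).
Let W i := snd (nth i E d0).
Let N := length E.
Let ind (b : bool) : Z := if b then 1%Z else 0%Z.

Lemma cut_zsum S : Z.of_nat (cut E S) = zsum N (fun i => ind (xorb (S (U i)) (S (W i)))).
Proof.
  assert (H : forall l, Z.of_nat (cut l S) =
    zsum (length l) (fun i => ind (xorb (S (fst (nth i l d0))) (S (snd (nth i l d0)))))).
  { intros l. induction l as [|e l IH] using rev_ind; [auto|].
    rewrite cut_app, length_app, Nat.add_1_r. simpl.
    rewrite (@zsum_ext _ _ (fun i => ind (xorb (S (fst (nth i l d0))) (S (snd (nth i l d0)))))).
    - rewrite <- IH, app_nth2, Nat.sub_diag by lia. simpl. unfold cut, count. simpl.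
      destruct (xorb _ _); simpl; lia.
    - intros i Hi. rewrite app_nth1; auto. }
  apply H.
Qed.

(* A path whose step along edge [i] in direction [s] (1: forwards, -1: backwards) satisfies [ok i s];
   [g] is the unit flow along it. *)
Inductive fpath (ok : nat -> Z -> Prop) : V -> V -> list V -> list nat -> (nat -> Z) -> Prop :=
| fpath_nil a : fpath ok a a [a] [] (fun _ => 0%Z)
| fpath_cons a y b vs es g i s :
    s = 1%Z /\ U i = a /\ W i = y \/ s = (-1)%Z /\ W i = a /\ U i = y ->
    i < N -> ok i s -> fpath ok y b vs es g -> ~ In a vs ->
    fpath ok a b (a :: vs) (i :: es) (fun j => if j =? i then s else g j).

Lemma fpath_head ok a b vs es g : fpath ok a b vs es g -> exists vs', vs = a :: vs'.
Proof. destruct 1; eauto. Qed.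

Lemma fpath_ends ok a b vs es g i : fpath ok a b vs es g -> In i es -> In (U i) vs /\ In (W i) vs.
Proof.
  induction 1 as [|a y b vs es g j s Hs Hj Hok Hp IH Ha]; intros Hi; [destruct Hi|].
  destruct (fpath_head Hp) as [vs' ->].
  destruct Hi as [->|Hi]; [destruct Hs as [(_ & -> & ->)|(_ & -> & ->)]; simpl; auto|].
  split; right; apply IH, Hi.
Qed.

Lemma fpath_out ok a b vs es g j : fpath ok a b vs es g -> ~ In j es -> g j = 0%Z.
Proof.
  induction 1 as [|a y b vs es g i s Hs Hi Hok Hp IH Ha]; intros Hj; [auto|].
  destruct (Nat.eqb_spec j i) as [->|]; [simpl in Hj; tauto|]. apply IH. simpl in Hj; tauto.
Qed.

Lemma fpath_new ok a y b vs es g i s :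
  s = 1%Z /\ U i = a /\ W i = y \/ s = (-1)%Z /\ W i = a /\ U i = y ->
  fpath ok y b vs es g -> ~ In a vs -> ~ In i es.
Proof.
  intros Hs Hp Ha Hi. destruct (fpath_ends _ Hp Hi).
  destruct Hs as [(_ & <- & _)|(_ & <- & _)]; auto.
Qed.

Lemma fpath_in ok a b vs es g j :
  fpath ok a b vs es g -> In j es -> ok j (g j) /\ (g j = 1 \/ g j = -1)%Z /\ j < N.
Proof.
  induction 1 as [|a y b vs es g i s Hs Hi Hok Hp IH Ha]; intros Hj; [destruct Hj|].
  destruct (Nat.eqb_spec j i) as [->|].
  - split; [auto|]. split; [|auto]. destruct Hs as [(-> & _)|(-> & _)]; auto.
  - apply IH. destruct Hj; congruence.
Qed.

Definition net (f : nat -> Z) (S : V -> bool) : Z :=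
  zsum N (fun i => f i * (ind (S (U i)) - ind (S (W i))))%Z.

Lemma fpath_net ok a b vs es g S :
  fpath ok a b vs es g -> net g S = (ind (S a) - ind (S b))%Z.
Proof.
  induction 1 as [|a y b vs es g i s Hs Hi Hok Hp IH Ha]; unfold net in *.
  - rewrite (@zsum_ext _ _ (fun _ => 0%Z)) by (intros; lia).
    assert (forall n, zsum n (fun _ => 0%Z) = 0%Z) by (induction n; simpl; lia). rewrite H. lia.
  - pose proof (@fpath_new _ _ _ _ _ _ _ i s Hs Hp Ha) as Hnew. pose proof (fpath_out _ Hp Hnew) as Hgi.
    set (h := fun j => ((if (j =? i)%nat then s else 0) * (ind (S (U j)) - ind (S (W j))))%Z).
    rewrite (@zsum_ext _ _ (fun j => (g j * (ind (S (U j)) - ind (S (W j))) + h j)%Z)).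
    + rewrite zsum_add, IH, (@zsum_single N h i); auto; unfold h.
      * rewrite Nat.eqb_refl. destruct Hs as [(-> & <- & <-)|(-> & <- & <-)]; lia.
      * intros j _ Hj. destruct (Nat.eqb_spec j i); [congruence|lia].
    + intros j _. unfold h. destruct (Nat.eqb_spec j i) as [->|]; [rewrite Hgi|]; lia.
Qed.

Lemma fpath_suffix ok a y b vs es g :
  fpath ok y b vs es g -> In a vs -> exists vs' es' g', fpath ok a b vs' es' g'.
Proof.
  induction 1 as [|x y b vs es g i s Hs Hi Hok Hp IH Ha]; intros H.
  - destruct H as [->|[]]. exists [a], [], (fun _ => 0%Z). constructor.
  - destruct H as [->|H]; [|auto]. do 3 eexists. econstructor; eauto.
Qed.

Definition reaches ok b a := exists vs es g, fpath ok a b vs es g.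

Lemma reaches_step (ok : nat -> Z -> Prop) a y b i s :
  s = 1%Z /\ U i = a /\ W i = y \/ s = (-1)%Z /\ W i = a /\ U i = y ->
  i < N -> ok i s -> reaches ok b y -> reaches ok b a.
Proof.
  intros Hs Hi Hok (vs & es & g & Hp).
  destruct (classic (In a vs)) as [Ha|Ha]; [apply (fpath_suffix _ Hp Ha)|].
  do 3 eexists. econstructor; eauto.
Qed.

Definition unreached (ok : nat -> Z -> Prop) b : V -> bool := fun x => negb (dec (reaches ok b x)).

Lemma unreached_spec ok a b : ~ reaches ok b a -> unreached ok b a = true /\ unreached ok b b = false.
Proof.
  intros H. unfold unreached. split.
  - apply negb_true_iff, decF, H.
  - apply negb_false_iff, decT. exists [b], [], (fun _ => 0%Z). constructor.
Qed.

Lemma unreached_closed (ok : nat -> Z -> Prop) b i :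
  i < N -> let S := unreached ok b in
  (S (U i) = true -> S (W i) = false -> ~ ok i 1%Z) /\
  (S (U i) = false -> S (W i) = true -> ~ ok i (-1)%Z).
Proof.
  intros Hi S. unfold S, unreached. split; intros H1 H2 Hok;
    rewrite negb_true_iff, decF in *; rewrite negb_false_iff, decT in *.
  - apply H1. apply (@reaches_step ok (U i) (W i) b i 1%Z); auto.
  - apply H2. apply (@reaches_step ok (W i) (U i) b i (-1)%Z); auto.
Qed.

(** Prescribing the net outflow of every vertex set encodes conservation and value at once, without
    a sum over the possibly infinite vertex set. *)
Definition flow (a b : V) (m : Z) (f : nat -> Z) : Prop :=
  (forall i, -1 <= f i <= 1)%Z /\ forall S, net f S = (m * (ind (S a) - ind (S b)))%Z.

(** Augmenting paths: if there is none, every edge between the vertices that cannot reach [b] and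
    the others carries a full unit outwards, so the value is the size of a cut. *)
Lemma flow_exists a b l :
  (forall S, S a = true -> S b = false -> l <= cut E S) ->
  forall m, m <= l -> exists f, flow a b (Z.of_nat m) f.
Proof.
  intros Hcut. induction m as [|m IH]; intros Hm.
  - exists (fun _ => 0%Z). split; [lia|]. intros S. unfold net.
    rewrite (@zsum_ext _ _ (fun _ => 0%Z)) by (intros; lia).
    assert (forall n, zsum n (fun _ => 0%Z) = 0%Z) by (induction n; simpl; lia). rewrite H. lia.
  - destruct IH as [f [Hf Hnet]]; [lia|].
    (* An edge can take one more unit in direction [s] unless it already carries [s]. *)
    set (ok := fun i s => f i <> s).
    destruct (classic (reaches ok b a)) as [(vs & es & g & Hp)|HN].
    + exists (fun i => f i + g i)%Z. split.
      * intros i. specialize (Hf i). destruct (in_dec Nat.eq_dec i es) as [Hi|Hi].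
        -- destruct (fpath_in _ Hp Hi) as (H1 & H2 & _). unfold ok in H1. lia.
        -- rewrite (fpath_out _ Hp Hi). lia.
      * intros S. pose proof (fpath_net S Hp) as Hg. specialize (Hnet S). unfold net in *.
        rewrite (@zsum_ext _ _ (fun i => f i * (ind (S (U i)) - ind (S (W i))) +
          g i * (ind (S (U i)) - ind (S (W i))))%Z) by (intros; lia).
        rewrite zsum_add, Hnet, Hg. lia.
    + exfalso. destruct (unreached_spec HN) as [Ta Tb].
      specialize (Hcut _ Ta Tb). specialize (Hnet (unreached ok b)). rewrite Ta, Tb in Hnet.
      assert (net f (unreached ok b) = Z.of_nat (cut E (unreached ok b))).
      { rewrite cut_zsum. apply zsum_ext. intros i Hi.
        destruct (unreached_closed ok b Hi) as [H1 H2]. unfold ok in H1, H2. simpl in H1, H2.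
        destruct (unreached _ b (U i)), (unreached _ b (W i)); simpl; [lia| | |lia].
        - assert (f i = 1)%Z by (apply NNPP; auto). lia.
        - assert (f i = -1)%Z by (apply NNPP; auto). lia. }
      simpl in Hnet. lia.
Qed.

(** Subtracting a path along the flow makes the flow vanish on its edges, and later paths use only
    edges with nonzero flow. If no such path existed, the vertices that cannot reach [b] would have
    no positive net outflow. *)
Lemma flow_paths a b m : forall f, flow a b (Z.of_nat m) f ->
  exists Ps : list (list V * list nat), length Ps = m /\
    Forall (fun P => exists ok g, fpath ok a b (fst P) (snd P) g) Ps /\
    Forall (fun P => forall i, In i (snd P) -> f i <> 0%Z) Ps /\
    ForallOrdPairs (fun P Q => forall i, In i (snd P) -> ~ In i (snd Q)) Ps.
Proof.
  induction m as [|m IH]; intros f [Hf Hnet]; [exists []; repeat constructor|].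
  set (ok := fun i s => f i = s).
  destruct (classic (reaches ok b a)) as [(vs & es & g & Hp)|HN].
  - destruct (IH (fun i => f i - g i)%Z) as (Ps & HPl & HPp & HPs & HPd).
    + split.
      * intros i. specialize (Hf i). destruct (in_dec Nat.eq_dec i es) as [Hi|Hi].
        -- destruct (fpath_in _ Hp Hi) as (H1 & _). unfold ok in H1. lia.
        -- rewrite (fpath_out _ Hp Hi). lia.
      * intros S. pose proof (fpath_net S Hp) as Hg. specialize (Hnet S). unfold net in *.
        set (h := fun i => ((f i - g i) * (ind (S (U i)) - ind (S (W i))))%Z).
        rewrite (@zsum_ext _ _ (fun i => h i + g i * (ind (S (U i)) - ind (S (W i))))%Z) in Hnet
          by (intros; unfold h; lia).
        rewrite zsum_add, Hg in Hnet. lia.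
    + assert (HP0 : forall i, In i es -> (f i - g i = 0)%Z).
      { intros i Hi. destruct (fpath_in _ Hp Hi) as (H1 & _). unfold ok in H1. lia. }
      exists ((vs, es) :: Ps). split; [simpl; lia|]. split; [constructor; eauto|]. split.
      * constructor.
        -- intros i Hi. destruct (fpath_in _ Hp Hi) as (H1 & H2 & _). unfold ok in H1. lia.
        -- rewrite Forall_forall in *. intros P HP i Hi H0. apply (HPs P HP i Hi).
           destruct (in_dec Nat.eq_dec i es) as [Hi'|Hi']; [auto|]. rewrite (fpath_out _ Hp Hi'). lia.
      * constructor; auto. rewrite Forall_forall in *. intros P HP i Hi Hi'.
        apply (HPs P HP i Hi'). auto.
  - exfalso. destruct (unreached_spec HN) as [Ta Tb].
    specialize (Hnet (unreached ok b)). rewrite Ta, Tb in Hnet.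
    assert (net f (unreached ok b) <= zsum N (fun _ => 0%Z))%Z.
    { apply zsum_le. intros i Hi. specialize (Hf i).
      destruct (unreached_closed ok b Hi) as [H1 H2]. unfold ok in H1, H2. simpl in H1, H2.
      destruct (unreached _ b (U i)), (unreached _ b (W i)); simpl; [lia| | |lia].
      - assert (f i <> 1)%Z by auto. lia.
      - assert (f i <> -1)%Z by auto. lia. }
    assert (forall n, zsum n (fun _ => 0%Z) = 0%Z) by (induction n; simpl; lia).
    rewrite H0 in H. simpl in Hnet. lia.
Qed.

Lemma fpath_hpath (ok : nat -> Z -> Prop) (P : nat -> Prop) a b vs es g :
  (forall i s, ok i s -> P i) -> fpath ok a b vs es g -> hpath E P vs es a b.
Proof.
  intros HP Hp.
  (* The default value in [hpath] is the start vertex, which changes along the path; the induction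
     therefore treats all defaults. *)
  assert (H : length vs = S (length es) /\ NoDup vs /\ hd_error vs = Some a /\
    (forall d, last vs d = b) /\
    forall c i, i < length es ->
    P (nth i es 0) /\ nth i es 0 < length E /\
    ((fst (nth (nth i es 0) E (c, c)) = nth i vs c /\
      snd (nth (nth i es 0) E (c, c)) = nth (S i) vs c) \/
     (snd (nth (nth i es 0) E (c, c)) = nth i vs c /\
      fst (nth (nth i es 0) E (c, c)) = nth (S i) vs c))).
  { induction Hp as [a|a y b vs es g i s Hs Hi Hok Hp IH Ha].
    - repeat split; auto; try (repeat constructor; intros []); simpl in *; lia.
    - destruct IH as (IH1 & IH2 & IH3 & IH4 & IH5).
      destruct (fpath_head Hp) as [vs' ->].
      split; [simpl in *; lia|]. split; [constructor; auto|]. split; [auto|].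
      split; [intros d; apply (IH4 d)|].
      intros c [|j] Hj; [|apply (IH5 c j); simpl in Hj; lia].
      simpl. split; [apply (HP i s), Hok|]. split; [exact Hi|].
      rewrite (nth_indep E (c, c) d0 Hi).
      destruct Hs as [(_ & H1 & H2)|(_ & H1 & H2)]; auto. }
  destruct H as (H1 & H2 & H3 & H4 & H5). repeat (split; [solve [auto]|]). apply H5.
Qed.

Lemma menger a b l :
  (forall S, S a = true -> S b = false -> l <= cut E S) -> lambda_ge E a b l.
Proof.
  intros H. destruct (@flow_exists a b l H l (le_n l)) as [f Hf].
  destruct (flow_paths _ Hf) as (Ps & H1 & H2 & _ & H3). exists Ps. split; [auto|]. split; [|auto].
  rewrite Forall_forall in *. intros P HP. destruct (H2 P HP) as (ok & g & Hg).
  apply (@fpath_hpath ok _ _ _ _ _ g); auto.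
Qed.

(** If no path avoids [F], all edges leaving the set of vertices that cannot reach [v] have their
    indices in [F]. *)
Lemma h_connected_of_cuts (F : list nat) u v :
  (forall S, S u = true -> S v = false -> length F < cut E S) ->
  exists vs es, hpath E (fun i => ~ In i F) vs es u v.
Proof.
  intros H. set (ok := fun (i : nat) (s : Z) => ~ In i F).
  destruct (classic (reaches ok v u)) as [(vs & es & g & Hp)|HN].
  - exists vs, es. apply (@fpath_hpath ok _ _ _ _ _ g); auto.
  - exfalso. destruct (unreached_spec HN) as [Tu Tv].
    specialize (H _ Tu Tv). apply (Nat.lt_irrefl (length F)).
    eapply Nat.lt_le_trans; [exact H|].
    set (S := unreached ok v) in *.
    assert (HC : forall n, n <= N -> zsum n (fun i => ind (xorb (S (U i)) (S (W i)))) =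
      Z.of_nat (length (filter (fun i => xorb (S (U i)) (S (W i))) (seq 0 n)))).
    { induction n as [|n IH]; intros Hn; [auto|].
      rewrite seq_S, filter_app, length_app. simpl. rewrite IH by lia.
      destruct (xorb _ _); simpl; lia. }
    apply Nat2Z.inj_le. rewrite cut_zsum, HC by auto.
    apply inj_le. apply NoDup_incl_length; [apply NoDup_filter, seq_NoDup|].
    intros i Hi. apply filter_In in Hi. destruct Hi as [Hi Hx]. apply in_seq in Hi.
    destruct (@unreached_closed ok v i) as [H1 H2]; [lia|]. fold S in H1, H2. unfold ok in H1, H2.
    apply NNPP. intros Hi'. destruct (S (U i)), (S (W i)); simpl in Hx; try discriminate;
      [apply H1 | apply H2]; auto.
Qed.
End Flow.

(** * Paths of the graph *)

Section Paths.
Context {V : Type}.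
Implicit Types (P : V -> V -> Prop) (p : list V).

Lemma gpath_nil P a : gpath P [a] a a.
Proof. repeat split; try discriminate; simpl; auto. repeat constructor. intros []. Qed.

Lemma last_default (z : V) p d d' : last (z :: p) d = last (z :: p) d'.
Proof. revert z. induction p as [|y p IH]; intros z; [auto|]. apply (IH y). Qed.

Lemma gpath_cons P a y b p : P a y -> gpath P p y b -> ~ In a p -> gpath P (a :: p) a b.
Proof.
  intros Hay (Hn & Hd & Hw & Hh & Hl) Ha. destruct p as [|z p]; [congruence|].
  simpl in Hh. injection Hh as ->. repeat split; try discriminate; auto.
  - constructor; auto.
  - rewrite <- Hl. apply (last_default y p a y).
Qed.

Lemma gpath_induct P (Q : list V -> V -> V -> Prop) :
  (forall a, Q [a] a a) ->
  (forall a y b p, P a y -> gpath P p y b -> ~ In a p -> Q p y b -> Q (a :: p) a b) ->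
  forall p a b, gpath P p a b -> Q p a b.
Proof.
  intros H0 HS. induction p as [|z p IH]; intros a b (Hn & Hd & Hw & Hh & Hl); [congruence|].
  simpl in Hh. injection Hh as ->. destruct p as [|y p]; [simpl in Hl; subst; auto|].
  inversion Hd as [|? ? Ha Hd']; subst. destruct Hw as [Hay Hw].
  assert (Hp : gpath P (y :: p) y (last (a :: y :: p) a)).
  { repeat split; try discriminate; auto. apply (last_default y p y a). }
  apply (HS a y); auto.
Qed.

Lemma gpath_head P p a b : gpath P p a b -> exists p', p = a :: p'.
Proof.
  intros (Hn & _ & _ & Hh & _). destruct p as [|z p]; [congruence|].
  simpl in Hh. injection Hh as ->. eauto.
Qed.

Lemma gpath_last P p a b : gpath P p a b -> In b p.
Proof. intros H. pattern p, a, b. revert p a b H. apply gpath_induct; simpl; auto. Qed.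

Lemma gpath_suffix P p a b x : gpath P p a b -> In x p -> exists q, gpath P q x b.
Proof.
  intros H. revert x. pattern p, a, b. revert p a b H. apply gpath_induct.
  - intros a x [->|[]]. exists [x]. apply gpath_nil.
  - intros a y b p Hay Hp Ha IH x [->|Hx]; [|auto]. exists (x :: p). apply (gpath_cons _ Hay Hp Ha).
Qed.

(** Pieces of rays and links are concatenated in this closure, and repeated vertices are removed
    only once, at the end. *)
Definition conn P : V -> V -> Prop := clos_refl_trans V P.

Lemma conn_gpath P u v : conn P u v -> exists p, gpath P p u v.
Proof.
  intros H. apply clos_rt_rt1n in H. induction H as [u|u y v Huy _ [p Hp]].
  - exists [u]. apply gpath_nil.
  - destruct (classic (In u p)) as [Hu|Hu]; [apply (gpath_suffix _ Hp Hu)|].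
    exists (u :: p). apply (gpath_cons _ Huy Hp Hu).
Qed.

Lemma gpath_conn P p u v : gpath P p u v -> conn P u v.
Proof.
  intros H. pattern p, u, v. revert p u v H. apply gpath_induct.
  - intros a. apply rt_refl.
  - intros a y b p Hay _ _ IH. apply rt_trans with y; [apply rt_step|]; auto.
Qed.

Lemma conn_sym P u v : (forall x y, P x y -> P y x) -> conn P u v -> conn P v u.
Proof.
  intros HP H. induction H; [apply rt_step; auto|apply rt_refl|apply rt_trans with y; auto].
Qed.

Lemma conn_mono P P' u v : (forall x y, P x y -> P' x y) -> conn P u v -> conn P' u v.
Proof.
  intros HP H. induction H; [apply rt_step; auto|apply rt_refl|apply rt_trans with y; auto].
Qed.

Lemma pedge_sym p u v : pedge p u v -> pedge p v u.
Proof.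
  induction p as [|a [|b p] IH]; simpl; auto. intros [H|H]; [left; tauto|right; apply IH, H].
Qed.

Lemma pedge_In p u v : pedge p u v -> In u p /\ In v p.
Proof.
  induction p as [|a [|b p] IH]; [intros []|intros []|]. intros [H|H].
  - simpl. destruct H as [[-> ->]|[-> ->]]; auto.
  - split; right; apply IH, H.
Qed.

Lemma gwalk_pedge P p u v : gwalk P p -> pedge p u v -> P u v \/ P v u.
Proof.
  induction p as [|a [|b p] IH]; [intros _ []|intros _ []|]. intros [Hab Hw] [H|H].
  - destruct H as [[-> ->]|[-> ->]]; auto.
  - apply IH; auto.
Qed.

Lemma gpath_mono P P' p u v : (forall x y, P x y -> P' x y) -> gpath P p u v -> gpath P' p u v.
Proof.
  intros HP (H1 & H2 & H3 & H4 & H5). do 2 (split; [auto|]). split; [|auto]. clear - HP H3.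
  induction p as [|a [|b p] IH]; [auto|auto|]. destruct H3. split; [auto|]. apply IH. auto.
Qed.

Lemma gpath_pedge_conn P p u v : gpath P p u v -> conn (pedge p) u v.
Proof.
  intros H. pattern p, u, v. revert p u v H. apply gpath_induct.
  - intros a. apply rt_refl.
  - intros a y b p _ Hp _ IH. destruct Hp as (Hn & _ & _ & Hh & _).
    destruct p as [|z p]; [congruence|]. simpl in Hh. injection Hh as ->.
    apply rt_trans with y; [apply rt_step; simpl; auto|].
    revert IH. apply conn_mono. intros x z H. right. exact H.
Qed.

(** Edge-disjointness of paths is thereby reduced to disjointness of the relations [P] that supply
    their edges. *)
Lemma path_within (adj P : V -> V -> Prop) u v :
  (forall x y, P x y -> adj x y) -> (forall x y, P x y -> P y x) -> conn P u v ->
  exists p, gpath adj p u v /\ forall x y, pedge p x y -> P x y.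
Proof.
  intros H1 H2 H. destruct (conn_gpath H) as [p Hp]. exists p. split; [apply (gpath_mono _ H1 Hp)|].
  intros x y Hxy. destruct Hp as (_ & _ & Hw & _). destruct (@gwalk_pedge P p x y Hw Hxy); auto.
Qed.

Lemma last_hit P (Q : V -> Prop) p a b :
  gpath P p a b -> (exists x, In x p /\ Q x) ->
  exists q a', gpath P q a' b /\ Q a' /\ incl q p /\ forall x, In x q -> Q x -> x = a'.
Proof.
  intros H. pattern p, a, b. revert p a b H. apply gpath_induct.
  - intros a (x & [->|[]] & Hx). exists [x], x. split; [apply gpath_nil|]. split; [auto|].
    split; [apply incl_refl|]. intros y [->|[]]; auto.
  - intros a y b p Hay Hp Ha IH (x & Hx & Qx).
    destruct (classic (exists x, In x p /\ Q x)) as [HE|HE].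
    + destruct (IH HE) as (q & a' & H1 & H2 & H3 & H4). exists q, a'. do 2 (split; [auto|]).
      split; [|auto]. intros z Hz. right. auto.
    + destruct Hx as [->|Hx]; [|exfalso; eauto]. exists (x :: p), x.
      split; [apply (gpath_cons _ Hay Hp Ha)|]. split; [auto|]. split; [apply incl_refl|].
      intros z [->|Hz] Qz; [auto|]. exfalso; eauto.
Qed.

Lemma first_hit P (Q : V -> Prop) p a b :
  gpath P p a b -> Q b ->
  exists q b', gpath P q a b' /\ Q b' /\ incl q p /\ forall x, In x q -> Q x -> x = b'.
Proof.
  intros H. pattern p, a, b. revert p a b H. apply gpath_induct.
  - intros a Qa. exists [a], a. split; [apply gpath_nil|]. split; [auto|].
    split; [apply incl_refl|]. intros y [->|[]]; auto.
  - intros a y b p Hay Hp Ha IH Qb.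
    destruct (classic (Q a)) as [Qa|Qa].
    + exists [a], a. split; [apply gpath_nil|]. split; [auto|].
      split; [intros z [->|[]]; simpl; auto|]. intros z [->|[]]; auto.
    + destruct (IH Qb) as (q & b' & H1 & H2 & H3 & H4). exists (a :: q), b'.
      split; [apply (gpath_cons _ Hay H1); auto|]. split; [auto|].
      split; [intros z [->|Hz]; simpl; auto|]. intros z [->|Hz] Qz; [contradiction|auto].
Qed.

(** Otherwise a choice of one vertex of [F] on each path would be injective. *)
Lemma disjoint_paths_avoid (Ps : nat -> list V) (F : list V) :
  (forall i j, i <> j -> forall x, In x (Ps i) -> ~ In x (Ps j)) ->
  exists i, forall x, In x (Ps i) -> ~ In x F.
Proof.
  intros HD. apply NNPP. intros HN.
  assert (H : forall i, exists x, In x (Ps i) /\ In x F).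
  { intros i. apply NNPP. intros Hi. apply HN. exists i. intros x Hx HF. eauto. }
  set (c := fun i => proj1_sig (constructive_indefinite_description _ (H i))).
  assert (Hc : forall i, In (c i) (Ps i) /\ In (c i) F)
    by (intros i; exact (proj2_sig (constructive_indefinite_description _ (H i)))).
  assert (Hl : length (map c (seq 0 (S (length F)))) <= length F).
  { apply NoDup_incl_length.
    - apply NoDup_map_NoDup_ForallPairs; [|apply seq_NoDup].
      intros i j _ _ E. apply NNPP. intros Hij. destruct (Hc i) as [Hi _]. destruct (Hc j) as [Hj _].
      rewrite <- E in Hj. exact (HD _ _ Hij _ Hi Hj).
    - intros x Hx. apply in_map_iff in Hx. destruct Hx as (i & <- & _). apply Hc. }
  rewrite length_map, length_seq in Hl. lia.
Qed.
End Paths.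

Lemma degH_app {V} (x : V) l n l' m : degH x l n -> degH x l' m -> degH x (l ++ l') (n + m).
Proof. induction 1; simpl; auto; intros; constructor; auto. Qed.

Lemma degH_none {V} (x : V) l : (forall e, In e l -> fst e <> x /\ snd e <> x) -> degH x l 0.
Proof.
  induction l as [|[u v] l IH]; intros H; constructor.
  - apply (H (u, v)). simpl; auto.
  - apply (H (u, v)). simpl; auto.
  - apply IH. intros e He. apply H. simpl; auto.
Qed.

Lemma degH_cut {V} (x : V) l n (S : V -> bool) :
  degH x l n -> (forall e, In e l -> fst e = x \/ snd e = x -> xorb (S (fst e)) (S (snd e)) = true) ->
  n <= cut l S.
Proof.
  induction 1; intros HS; [lia| |]; rewrite cut_cons.
  - replace (xorb (S u) (S v)) with true by (symmetry; apply (HS (u, v)); simpl; auto).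
    apply le_n_S, IHdegH. intros; apply HS; simpl; auto.
  - apply Nat.le_trans with (cut l S); [|lia]. apply IHdegH. intros; apply HS; simpl; auto.
Qed.

Lemma ForallOrdPairs_app {T} (Q : T -> T -> Prop) l m :
  ForallOrdPairs Q l -> ForallOrdPairs Q m -> (forall x y, In x l -> In y m -> Q x y) ->
  ForallOrdPairs Q (l ++ m).
Proof.
  induction 1 as [|x l Hx Hl IH]; intros Hm H; simpl; [auto|]. constructor.
  - apply Forall_app. split; [auto|]. apply Forall_forall. intros y Hy. apply H; simpl; auto.
  - apply IH; auto. intros; apply H; simpl; auto.
Qed.

(** * Realizing liftings in a boundary-linked component *)

Section Rays.
Context {V I : Type} (adj : V -> V -> Prop).
Context (adj_sym : forall u v, adj u v -> adj v u) (adj_irrefl : forall v, ~ adj v v).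
Context (A : list V) (B : V -> Prop) (R : I -> nat -> V).
Context (B_A : forall v, B v -> ~ In v A) (B_adj : forall u v, B u -> adj u v -> ~ In v A -> B v).
Context (R_ray : forall i, ray adj (R i)).
Context (R_disj : forall i j, i <> j -> rays_edge_disjoint (R i) (R j)).
Context (R_equiv : forall i j, i <> j -> equiv_rays adj (R i) (R j)).

(** Such a ray stands for the edge from s to [R i 0]: its first edge is a boundary edge of [B]. *)
Definition enters (i : I) : Prop := In (R i 0) A /\ forall n, B (R i (S n)).

Definition eray (i : I) (u v : V) : Prop := exists n, redge (R i) n u v.

Let t (i : I) : V := R i 0.

Lemma redge_sym (r : nat -> V) n u v : redge r n u v -> redge r n v u.
Proof. unfold redge. tauto. Qed.

Lemma eray_sym i u v : eray i u v -> eray i v u.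
Proof. intros [n H]. exists n. apply redge_sym, H. Qed.

Lemma eray_disj i j u v : i <> j -> eray i u v -> ~ eray j u v.
Proof. intros H [n Hn] [m Hm]. exact (R_disj H Hn Hm). Qed.

Lemma redge_inj i n m u v : redge (R i) n u v -> redge (R i) m u v -> n = m.
Proof.
  destruct (R_ray i) as [Hi _].
  intros [[H1 H2]|[H1 H2]] [[H3 H4]|[H3 H4]]; subst.
  - apply Hi. auto.
  - apply Hi in H3, H4. lia.
  - apply Hi in H3, H4. lia.
  - apply Hi. auto.
Qed.

Lemma redge_adj i n u v : redge (R i) n u v -> adj u v.
Proof. destruct (R_ray i) as [_ Ha]. intros [[<- <-]|[<- <-]]; auto. Qed.

Lemma redge_B i n u v : enters i -> redge (R i) n u v -> B u \/ B v.
Proof. intros [_ HB] [[<- <-]|[<- <-]]; auto. Qed.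

Lemma conn_ray i (P : V -> V -> Prop) n m :
  (forall x, n <= x -> x < m -> P (R i x) (R i (S x))) -> n <= m -> conn P (R i n) (R i m).
Proof.
  intros H. induction 1 as [|m Hm IH]; [apply rt_refl|].
  apply rt_trans with (R i m); [apply IH; intros; apply H; lia|]. apply rt_step, H; lia.
Qed.

(* [L] supplies a path from the [n]-th vertex of [R p] to the [m]-th vertex of [R q] inside [B],
   outside [F], and edge-disjoint from the rays in [D]. *)
Definition link (D : list I) (F L : list V) (p : I) (n : nat) (q : I) (m : nat) : Prop :=
  conn (pedge L) (R p n) (R q m) /\
  (forall x y, pedge L x y -> adj x y /\ (B x /\ B y) /\ (~ In x F /\ ~ In y F) /\
     forall i, In i D -> ~ eray i x y) /\
  (B (R p n) /\ B (R q m)) /\ ~ In (R p n) F /\ ~ In (R q m) F.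

Lemma link_sym D F L p n q m : link D F L p n q m -> link D F L q m p n.
Proof.
  intros (H1 & H2 & [H3 H3'] & H4 & H5). split; [|split; auto].
  apply conn_sym; [apply pedge_sym | auto].
Qed.

Lemma link_mono D D' F F' L p n q m :
  incl D' D -> incl F' F -> link D F L p n q m -> link D' F' L p n q m.
Proof.
  intros HD HF (H1 & H2 & H3 & H4 & H5). split; [auto|]. split.
  - intros x y Hxy. destruct (H2 x y Hxy) as (Ha & Hb & [Hx Hy] & Hd).
    split; [auto|]. split; [auto|]. split; [split; auto|]. auto.
  - split; [auto|]. split; auto.
Qed.

Definition linkable D F p q := exists L n m, link D F L p n q m.

(** One of the disjoint paths between a ray of either side avoids [F] and [A]. It is cut at its last
    vertex on a ray of the first side and then at the first vertex on a ray of the other, so that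
    only its ends lie on rays of [D]. The rays hit may differ from the two rays started with. *)
Lemma linkable_meets_cuts D F : (forall i, In i D -> enters i) -> meets_cuts D (linkable D F).
Proof.
  intros HD P (p0 & Hp0 & Pp0) (q0 & Hq0 & Pq0).
  destruct (@R_equiv p0 q0) as (Ps & HPs & HPd); [congruence|].
  destruct (disjoint_paths_avoid Ps (F ++ A) HPd) as [i Hi].
  destruct (HPs i) as (n0 & m0 & H0).
  set (QP := fun v => exists p n, In p D /\ P p = true /\ R p n = v).
  set (QQ := fun v => exists q n, In q D /\ P q = false /\ R q n = v).
  assert (Hin : In (R p0 n0) (Ps i)).
  { destruct (gpath_head H0) as [p' ->]. simpl; auto. }
  destruct (@last_hit V adj QP _ _ _ H0) as (L1 & a & HL1 & Qa & I1 & U1).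
  { exists (R p0 n0). split; [auto|]. exists p0, n0. auto. }
  destruct (@first_hit V adj QQ _ _ _ HL1) as (L & b & HL & Qb & I2 & U2).
  { exists q0, m0. auto. }
  assert (HLF : forall x, In x L -> ~ In x F /\ ~ In x A).
  { intros x Hx. pose proof (Hi x (I1 _ (I2 _ Hx))) as H. rewrite in_app_iff in H. tauto. }
  destruct Qa as (p & n & Hp & Pp & <-). destruct Qb as (q & m & Hq & Pq & <-).
  (* The path starts in [B] and avoids [A], so it cannot leave [B]. *)
  assert (HB : forall x, In x L -> B x).
  { assert (Ha : B (R p n)).
    { assert (Hin' : In (R p n) L).
      { destruct (gpath_head HL) as [p' ->]. simpl; auto. }
      destruct (HD p Hp) as [HpA HpB]. destruct n; [|auto].
      exfalso. apply (proj2 (HLF _ Hin')). auto. }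
    clear - HL HLF Ha B_adj. revert HLF Ha. generalize (R p n) (R q m) HL. clear HL.
    intros u v HL. pattern L, u, v. revert L u v HL. apply gpath_induct.
    - intros u _ Hu x [->|[]]. auto.
    - intros u y w L Huy Hp _ IH HLF Hu x [->|Hx]; [auto|]. apply IH; auto.
      + intros; apply HLF; simpl; auto.
      + apply (B_adj Hu Huy). apply HLF. destruct (gpath_head Hp) as [L' ->]. simpl; auto. }
  exists p, q. do 4 (split; [auto|]). exists L, n, m.
  assert (Hends : In (R p n) L /\ In (R q m) L).
  { split; [destruct (gpath_head HL) as [L' ->]; simpl; auto | apply (gpath_last HL)]. }
  split; [apply (gpath_pedge_conn HL)|]. split.
  - intros x y Hxy. destruct (pedge_In _ _ _ Hxy) as [Hx Hy].
    assert (Axy : adj x y).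
    { destruct HL as (_ & _ & Hw & _). destruct (@gwalk_pedge V adj L x y Hw Hxy); auto. }
    split; [auto|]. split; [auto|]. split; [split; apply HLF; auto|].
    (* An edge shared with a ray of [D] would have both ends on rays of the same side, hence both
       equal to the same end of [L]. *)
    intros i' Hi' [l Hl].
    assert (Hr : exists l1 l2, R i' l1 = x /\ R i' l2 = y) by (destruct Hl as [[? ?]|[? ?]]; eauto).
    destruct Hr as (l1 & l2 & Hl1 & Hl2). apply (adj_irrefl (v := x)).
    replace y with x in Axy; [auto|]. destruct (P i') eqn:Pi.
    + rewrite (U1 x), (U1 y); auto; first [now apply I2 | exists i'; eauto].
    + rewrite (U2 x), (U2 y); auto; exists i'; eauto.
  - split; [split; apply HB; tauto|]. split; apply HLF; tauto.
Qed.

(* The paths of [new] use the rays [D1] and, apart from these, only edges that avoid [F] and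
   the rays [D2]. *)
Definition uses (D1 D2 : list I) (F : list V) (new : list ((V * V) * list V)) : Prop :=
  immersion adj new /\
    forall e, In e new -> forall u v, pedge (snd e) u v -> (B u \/ B v) /\
    ((exists i, In i D1 /\ eray i u v) \/
     ((~ In u F /\ ~ In v F) /\ forall i, In i D2 -> ~ eray i u v)).

Definition vertices (new : list ((V * V) * list V)) : list V := flat_map snd new.

Lemma uses_mono D1 D1' D2 D2' F F' new :
  incl D1 D1' -> incl D2' D2 -> incl F' F -> uses D1 D2 F new -> uses D1' D2' F' new.
Proof.
  intros H1 H2 HF [Hi H]. split; [auto|]. intros e He u v Huv.
  destruct (H e He u v Huv) as [HB [(i & Hi1 & Hi2)|[[Hu Hv] Hr]]]; (split; [auto|]).
  - left. eauto.
  - right. split; [split|]; auto.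
Qed.

Lemma uses_nil D1 D2 F : uses D1 D2 F [].
Proof. split; [split; constructor|]. intros e []. Qed.

(** An edge of [rest] lies on a ray of [D2], which [new] does not use, or has its ends off the
    vertices of [new]. *)
Lemma uses_app D1 D2 F new rest :
  (forall i, In i D1 -> ~ In i D2) ->
  uses D1 D2 F new -> uses D2 [] (F ++ vertices new) rest -> uses (D1 ++ D2) [] F (new ++ rest).
Proof.
  intros HD [[HN1 HN2] HN] [[HR1 HR2] HR]. split; [split|].
  - apply Forall_app. auto.
  - apply ForallOrdPairs_app; auto. intros e f He Hf u v Hu Hv.
    destruct (HN e He u v Hu) as [_ Hn]. destruct (HR f Hf u v Hv) as [_ Hr].
    destruct Hr as [(j & Hj & Hju)|[[Hfu _] _]].
    + destruct Hn as [(i & Hi & Hiu)|[_ Hn]]; [|exact (Hn j Hj Hju)].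
      apply (@eray_disj i j u v); auto. intros ->. exact (HD j Hi Hj).
    + apply Hfu. apply in_app_iff. right. apply in_flat_map. exists e. split; [auto|].
      apply (pedge_In _ _ _ Hu).
  - intros e He u v Huv. apply in_app_iff in He. destruct He as [He|He].
    + destruct (HN e He u v Huv) as [HB [(i & Hi1 & Hi2)|[HF _]]]; (split; [auto|]).
      * left. exists i. rewrite in_app_iff. auto.
      * right. split; [auto|]. intros i [].
    + destruct (HR e He u v Huv) as [HB [(i & Hi1 & Hi2)|[HF _]]]; (split; [auto|]).
      * left. exists i. rewrite in_app_iff. auto.
      * right. rewrite !in_app_iff in HF. split; [tauto|]. intros i [].
Qed.

(** The second end of each edge is always in [A], which makes [xs] independent. *)
Definition proper (xs : list V) (H : list (V * V)) : Prop :=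
  (forall e, In e H -> (In (fst e) A \/ In (fst e) xs) /\ In (snd e) A /\ fst e <> snd e) /\
    forall x, In x xs -> B x /\ degH x H 3.

Lemma proper_app xs H H' : proper [] H -> proper xs H' -> proper xs (H ++ H').
Proof.
  intros [H1 _] [H2 H3]. split.
  - intros e He. apply in_app_iff in He. destruct He as [He|He]; [|auto].
    destruct (H1 e He) as ([?|[]] & ? & ?). auto.
  - intros x Hx. destruct (H3 x Hx) as [Bx Dx]. split; [auto|]. change 3 with (0 + 3).
    apply degH_app; [|auto]. apply degH_none. intros e He.
    destruct (H1 e He) as ([Ha|[]] & Hb & _). split; intros E; rewrite E in *; exact (B_A Bx ltac:(assumption)).
Qed.

(** The path follows one ray, the link, and the other ray backwards. Only cuts are compared with the
    lifted edge, because it is a loop if both rays start at the same vertex, and loops are left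
    out. *)
Lemma realize_link D D2 F L p n q m :
  In p D -> In q D -> incl D2 D -> enters p -> enters q -> link D F L p n q m ->
  exists new, uses [p; q] D2 F new /\ proper [] (map fst new) /\
    forall S, cut (map fst new) S = cut [(t p, t q)] S.
Proof.
  intros Hp Hq HD2 Ep Eq (HC & HL & _).
  destruct (classic (t p = t q)) as [Heq|Hne].
  { exists []. split; [apply uses_nil|]. split; [split; intros ? []|].
    intros S. rewrite Heq, cut_cons, xorb_nilpotent. reflexivity. }
  destruct (@path_within V adj (fun u v => eray p u v \/ eray q u v \/ pedge L u v) (t p) (t q))
    as (P & HP & HPe).
  { intros x y [[l H]|[[l H]|H]]; [apply (redge_adj H)|apply (redge_adj H)|apply HL, H]. }
  { intros x y [H|[H|H]]; [left; apply eray_sym, H|right; left; apply eray_sym, H|].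
    right; right. apply pedge_sym, H. }
  { apply rt_trans with (R p n); [|apply rt_trans with (R q m)].
    - apply conn_ray; [|lia]. intros x _ _. left. exists x. left. auto.
    - revert HC. apply conn_mono. auto.
    - apply conn_sym; [|apply conn_ray; [|lia]].
      + intros x y [H|[H|H]]; [left; apply eray_sym, H|right; left; apply eray_sym, H|].
        right; right. apply pedge_sym, H.
      + intros x _ _. right. left. exists x. left. auto. }
  exists [((t p, t q), P)]. split; [split; [split|]|split; [split|]].
  - constructor; [exact HP|constructor].
  - repeat constructor.
  - intros e [<-|[]] u v Huv. simpl in Huv. destruct (HPe u v Huv) as [[l H]|[[l H]|H]].
    + split; [apply (redge_B Ep H)|]. left. exists p. split; [simpl; auto|]. exists l; auto.
    + split; [apply (redge_B Eq H)|]. left. exists q. split; [simpl; auto|]. exists l; auto.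
    + destruct (HL u v H) as (_ & HB & HF & Hr). split; [tauto|]. right. auto.
  - intros e [<-|[]]. simpl. destruct Ep, Eq. auto.
  - intros x [].
  - intros S. reflexivity.
Qed.

Definition initial (c : I) (n : nat) : list V := map (R c) (seq 0 (S n)).

Definition star (x : V) (D : list I) : list (V * V) := map (fun i => (x, t i)) D.

(* Both links reach [R c], the second one beyond the first: the latter's end is the centre. *)
Lemma realize_tripod D D2 F F2 L1 L2 c n1 n2 a m1 b m2 :
  In c D -> In a D -> In b D -> c <> a -> c <> b -> a <> b -> incl D2 D ->
  (forall i, In i D -> enters i) ->
  link D F L1 c n1 a m1 -> link D F2 L2 c n2 b m2 ->
  incl F F2 -> incl L1 F2 -> incl (initial c n1) F2 ->
  exists x new, uses [c; a; b] D2 F new /\ proper [x] (map fst new) /\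
    map fst new = star x [c; a; b].
Proof.
  intros Hc Ha Hb Hca Hcb Hab HD2 HD (C1 & E1 & [B1 _] & _) (C2 & E2 & _ & N2 & _) HF HL HI.
  (* The second link avoids the vertices of [R c] up to index [n1]. *)
  assert (Hn : n1 <= n2).
  { apply Nat.nlt_ge. intros Hlt. apply N2, HI. apply in_map_iff. exists n2. split; [auto|].
    apply in_seq. lia. }
  set (x := R c n1) in *.
  (* Three branches leave [x]: back along [R c]; through [L1] and back along [R a]; onwards along
     [R c], through [L2] and back along [R b]. *)
  set (P0 := fun u v => exists n, n < n1 /\ redge (R c) n u v).
  set (Pa := fun u v => eray a u v \/ pedge L1 u v).
  set (Pb := fun u v => (exists n, n1 <= n /\ redge (R c) n u v) \/ eray b u v \/ pedge L2 u v).
  assert (S0 : forall u v, P0 u v -> P0 v u).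
  { intros u v (n & H1 & H2). exists n. split; [auto|apply redge_sym, H2]. }
  assert (Sa : forall u v, Pa u v -> Pa v u).
  { intros u v [H|H]; [left; apply eray_sym, H|right; apply pedge_sym, H]. }
  assert (Sb : forall u v, Pb u v -> Pb v u).
  { intros u v [(n & H1 & H2)|[H|H]].
    - left. exists n. split; [auto|apply redge_sym, H2].
    - right; left; apply eray_sym, H.
    - right; right; apply pedge_sym, H. }
  destruct (@path_within V adj P0 x (t c)) as (T0 & HT0 & HT0e); auto.
  { intros u v (n & _ & H). apply (redge_adj H). }
  { apply conn_sym; [auto|]. apply conn_ray; [|lia]. intros y _ Hy. exists y. split; [auto|left; auto]. }
  destruct (@path_within V adj Pa x (t a)) as (Ta & HTa & HTae); auto.
  { intros u v [[n H]|H]; [apply (redge_adj H)|apply E1, H]. }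
  { apply rt_trans with (R a m1); [revert C1; apply conn_mono; unfold Pa; auto|].
    apply conn_sym; [auto|]. apply conn_ray; [|lia]. intros y _ _. left. exists y. left; auto. }
  destruct (@path_within V adj Pb x (t b)) as (Tb & HTb & HTbe); auto.
  { intros u v [(n & _ & H)|[[n H]|H]]; [apply (redge_adj H)|apply (redge_adj H)|apply E2, H]. }
  { apply rt_trans with (R c n2); [|apply rt_trans with (R b m2)].
    - apply conn_ray; [|lia]. intros y Hy _. left. exists y. split; [auto|left; auto].
    - revert C2; apply conn_mono; unfold Pb; auto.
    - apply conn_sym; [auto|]. apply conn_ray; [|lia]. intros y _ _. right; left. exists y. left; auto. }
  assert (D0a : forall u v, P0 u v -> ~ Pa u v).
  { intros u v (n & _ & H) [H'|H'].
    - apply (eray_disj (i := c) (j := a) (u := u) (v := v)); auto. exists n; auto.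
    - destruct (E1 u v H') as (_ & _ & _ & Hr). apply (Hr c Hc). exists n; auto. }
  assert (D0b : forall u v, P0 u v -> ~ Pb u v).
  { intros u v (n & Hlt & H) [(n' & Hle & H')|[H'|H']].
    - pose proof (redge_inj H H'). lia.
    - apply (eray_disj (i := c) (j := b) (u := u) (v := v)); auto. exists n; auto.
    - destruct (E2 u v H') as (_ & _ & _ & Hr). apply (Hr c Hc). exists n; auto. }
  assert (Dab : forall u v, Pa u v -> ~ Pb u v).
  { intros u v [H|H] [(n' & Hle & H')|[H'|H']].
    - apply (eray_disj (i := c) (j := a) (u := u) (v := v)); auto. exists n'; auto.
    - apply (eray_disj (i := a) (j := b) (u := u) (v := v)); auto.
    - destruct (E2 u v H') as (_ & _ & _ & Hr). apply (Hr a Ha H).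
    - destruct (E1 u v H) as (_ & _ & _ & Hr). apply (Hr c Hc). exists n'; auto.
    - destruct (E1 u v H) as (_ & _ & _ & Hr). apply (Hr b Hb H').
    - destruct (E2 u v H') as (_ & _ & [Hr _] & _). apply Hr, HL. apply (pedge_In _ _ _ H). }
  assert (HxA : forall i, In i D -> x <> t i).
  { intros i Hi Hx. apply (B_A B1). rewrite Hx. apply HD, Hi. }
  exists x, [((x, t c), T0); ((x, t a), Ta); ((x, t b), Tb)].
  split; [split; [split|]|split; [split|reflexivity]].
  - repeat (apply Forall_cons; [assumption|]). constructor.
  - constructor; [constructor; [|constructor; [|constructor]]|
      constructor; [constructor; [|constructor]|constructor; constructor]];
      intros u v Hu Hv; simpl in Hu, Hv.
    + exact (D0a u v (HT0e u v Hu) (HTae u v Hv)).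
    + exact (D0b u v (HT0e u v Hu) (HTbe u v Hv)).
    + exact (Dab u v (HTae u v Hu) (HTbe u v Hv)).
  - intros e He u v Huv.
    assert (Hray : forall i, In i [c; a; b] -> eray i u v ->
      (B u \/ B v) /\ ((exists i, In i [c; a; b] /\ eray i u v) \/
      ((~ In u F /\ ~ In v F) /\ forall i, In i D2 -> ~ eray i u v))).
    { intros i Hi Hr. split; [|left; eauto]. destruct Hr as [n Hr].
      apply (redge_B (i := i) (n := n)); auto. apply HD.
      destruct Hi as [<-|[<-|[<-|[]]]]; auto. }
    destruct He as [<-|[<-|[<-|[]]]]; simpl in Huv.
    + destruct (HT0e u v Huv) as (n & _ & H). apply (Hray c); [simpl; auto|exists n; auto].
    + destruct (HTae u v Huv) as [H|H]; [apply (Hray a); simpl; auto|].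
      destruct (E1 u v H) as (_ & HB & HFuv & Hr). split; [tauto|]. right. auto.
    + destruct (HTbe u v Huv) as [(n & _ & H)|[H|H]].
      * apply (Hray c); [simpl; auto|exists n; auto].
      * apply (Hray b); simpl; auto.
      * destruct (E2 u v H) as (_ & HB & [Hu Hv] & Hr). split; [tauto|]. right.
        split; [split; auto|auto].
  - intros e He. simpl in He. destruct He as [<-|[<-|[<-|[]]]]; simpl;
      (split; [auto|]; split; [apply HD|apply HxA]; auto).
  - intros y [<-|[]]. split; [auto|]. simpl.
    repeat (apply degH_in; [auto|]). constructor.
Qed.

(** * Realizing liftings one after another *)

Definition lifts (M : list (I * I)) : list (V * V) := map (fun m => (t (fst m), t (snd m))) M.

(** The form with [rest] serves inductions on the rays: two rays are spent, and the vertices of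
    [new] become forbidden. *)
Lemma link_then D D2 F L p n q m :
  NoDup D -> (forall i, In i D -> enters i) -> Permutation D (p :: q :: D2) ->
  link D F L p n q m ->
  exists new, proper [] (map fst new) /\ (forall S, cut (map fst new) S = cut [(t p, t q)] S) /\
    forall rest, uses D2 [] (F ++ vertices new) rest -> uses D [] F (new ++ rest).
Proof.
  intros ND HD HP HL.
  assert (HI : incl (p :: q :: D2) D) by (intros i; apply Permutation_in, Permutation_sym, HP).
  assert (Hp : In p D) by (apply HI; simpl; auto).
  assert (Hq : In q D) by (apply HI; simpl; auto).
  destruct (@realize_link D D2 F L p n q m) as (new & H1 & H2 & H3); auto.
  { intros i Hi. apply HI. simpl; auto. }
  exists new. do 2 (split; [auto|]). intros rest Hr.
  apply (Permutation_NoDup HP) in ND. inversion ND as [|? ? N1 N2]; subst.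
  inversion N2 as [|? ? N3 N4]; subst.
  assert (HU : uses ([p; q] ++ D2) [] F (new ++ rest)).
  { apply uses_app; auto. intros i [<-|[<-|[]]]; simpl in N1; tauto. }
  revert HU. apply uses_mono; [exact HI|intros i []|apply incl_refl].
Qed.

Lemma tripod_then D D2 F F2 L1 L2 c n1 n2 a m1 b m2 :
  NoDup D -> (forall i, In i D -> enters i) -> Permutation D (c :: a :: b :: D2) ->
  link D F L1 c n1 a m1 -> link D F2 L2 c n2 b m2 ->
  incl F F2 -> incl L1 F2 -> incl (initial c n1) F2 ->
  exists x new, proper [x] (map fst new) /\ map fst new = star x [c; a; b] /\
    forall rest, uses D2 [] (F ++ vertices new) rest -> uses D [] F (new ++ rest).
Proof.
  intros ND HD HP HL1 HL2 H1 H2 H3.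
  assert (HI : incl (c :: a :: b :: D2) D) by (intros i; apply Permutation_in, Permutation_sym, HP).
  apply (Permutation_NoDup HP) in ND. inversion ND as [|? ? N1 N2]; subst.
  inversion N2 as [|? ? N3 N4]; subst. inversion N4 as [|? ? N5 N6]; subst.
  simpl in N1, N3.
  destruct (@realize_tripod D D2 F F2 L1 L2 c n1 n2 a m1 b m2) as (x & new & U1 & U2 & U3); auto;
    try (apply HI; simpl; tauto); try (intros ->; tauto).
  { intros i Hi. apply HI. simpl; auto. }
  exists x, new. do 2 (split; [auto|]). intros rest Hr.
  assert (HU : uses ([c; a; b] ++ D2) [] F (new ++ rest)).
  { apply uses_app; auto. intros i [<-|[<-|[<-|[]]]]; tauto. }
  revert HU. apply uses_mono; [exact HI|intros i []|apply incl_refl].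
Qed.

Lemma ordpairs_perm {T} (Q : T -> T -> Prop) l m : (forall x y, Q x y -> Q y x) ->
  Permutation l m -> ForallOrdPairs Q l -> ForallOrdPairs Q m.
Proof.
  intros HQ. induction 1 as [|x l m HP IH|x y l|l m r _ IH1 _ IH2]; intros H; auto.
  - inversion H; subst. constructor; [|auto]. rewrite <- HP. auto.
  - inversion H as [|? ? H1 H2]; subst. inversion H2; subst. inversion H1; subst.
    constructor; [constructor; auto|]. constructor; auto.
Qed.

Lemma uses_perm D1 D2 F new new' : uses D1 D2 F new -> Permutation new new' -> uses D1 D2 F new'.
Proof.
  intros [[H1 H2] H3] HP. split; [split|].
  - rewrite <- HP. auto.
  - revert H2. apply ordpairs_perm; auto. intros e f H u v He Hf. exact (H u v Hf He).
  - intros e He. apply H3. apply (Permutation_in _ (Permutation_sym HP) He).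
Qed.

Lemma in_perm {T} (l : list T) x : In x l -> exists l', Permutation l (x :: l').
Proof.
  intros H. destruct (in_split _ _ H) as (l1 & l2 & ->). exists (l1 ++ l2).
  symmetry. apply Permutation_middle.
Qed.

Lemma perm_pair_app {T} (U U' W W' : list T) p q :
  Permutation U (p :: U') -> Permutation W (q :: W') -> Permutation (U ++ W) (p :: q :: U' ++ W').
Proof.
  intros H1 H2. rewrite H1, H2. simpl. apply perm_skip. symmetry. apply Permutation_middle.
Qed.

(** Some pair across the bipartition into [U] and [W] is linkable, and any such pair is welcome. *)
Lemma realize_matching n : forall U W F, length U = n -> length W = n -> NoDup (U ++ W) ->
  (forall i, In i (U ++ W) -> enters i) ->
  exists M new, Permutation U (map fst M) /\ Permutation W (map snd M) /\
    uses (U ++ W) [] F new /\ proper [] (map fst new) /\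
    forall S, cut (map fst new) S = cut (lifts M) S.
Proof.
  induction n as [|n IH]; intros U W F HU HW ND HD.
  { apply length_zero_iff_nil in HU, HW. subst. exists [], []. repeat (split; [solve [auto]|]).
    split; [apply uses_nil|]. split; [split; intros ? []|]. reflexivity. }
  destruct (@linkable_meets_cuts _ F HD (fun i => dec (In i U))) as
    (p & q & Hp & Hq & Pp & Pq & L & n1 & m1 & HL).
  { destruct U as [|u U]; [discriminate|]. exists u. split; [simpl; auto|]. apply decT. simpl; auto. }
  { destruct W as [|w W]; [discriminate|]. exists w. split; [rewrite in_app_iff; simpl; auto|].
    apply decF. apply NoDup_remove_2 in ND. rewrite in_app_iff in ND. tauto. }
  rewrite decT in Pp. rewrite decF in Pq. apply in_app_iff in Hq. destruct Hq as [Hq|Hq]; [tauto|].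
  destruct (in_perm _ _ Pp) as [U' HU']. destruct (in_perm _ _ Hq) as [W' HW'].
  pose proof (perm_pair_app HU' HW') as HP.
  destruct (link_then ND HD HP HL) as (new & H1 & H2 & H3).
  destruct (IH U' W' (F ++ vertices new)) as (M & rest & M1 & M2 & M3 & M4 & M5).
  - apply Permutation_length in HU'. simpl in HU'. lia.
  - apply Permutation_length in HW'. simpl in HW'. lia.
  - apply (Permutation_NoDup HP) in ND. inversion ND; subst. inversion H5; subst. auto.
  - intros i Hi. apply HD. apply (Permutation_in _ (Permutation_sym HP)). simpl; auto.
  - exists ((p, q) :: M), (new ++ rest). simpl. split; [rewrite HU'; auto|]. split; [rewrite HW'; auto|].
    split; [auto|]. rewrite map_app. split; [apply proper_app; auto|].
    intros S. rewrite cut_app, H2, M5, !cut_cons. unfold cut at 1, count. simpl. lia.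
Qed.

(** A first link joins two of the rays, a second one joins the third ray to one of these. The ray
    reached twice carries the centre, at the end of the first link. *)
Lemma realize_three e f g F : NoDup [e; f; g] -> (forall i, In i [e; f; g] -> enters i) ->
  exists x new, uses [e; f; g] [] F new /\ proper [x] (map fst new) /\
    Permutation (map fst new) (star x [e; f; g]).
Proof.
  intros ND HD.
  assert (H : forall f' g' L1 n1 m1, Permutation [e; f; g] [e; f'; g'] ->
    link [e; f; g] F L1 e n1 f' m1 ->
    exists x new, uses [e; f; g] [] F new /\ proper [x] (map fst new) /\
    Permutation (map fst new) (star x [e; f; g])).
  { intros f' g' L1 n1 m1 HP HL1.
    (* Both initial segments are excluded, as it is not known which of the two rays the second link
       will reach. *)
    set (F2 := F ++ L1 ++ initial e n1 ++ initial f' m1).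
    assert (ND' := Permutation_NoDup HP ND).
    inversion ND' as [|? ? N1 N2]; subst. inversion N2 as [|? ? N3 N4]; subst. simpl in N1, N3.
    destruct (@linkable_meets_cuts _ F2 HD (fun i => dec (i = g'))) as
      (p & q & Hp & Hq & Pp & Pq & L2 & n2 & m2 & HL2).
    { exists g'. split; [|apply decT; auto].
      apply (Permutation_in _ (Permutation_sym HP)). simpl; auto. }
    { exists e. split; [simpl; auto|]. apply decF. intros ->. tauto. }
    rewrite decT in Pp. rewrite decF in Pq. subst p. apply link_sym in HL2.
    assert (HF2 : incl F F2 /\ incl L1 F2 /\ incl (initial e n1) F2 /\ incl (initial f' m1) F2).
    { unfold F2. repeat split; intros z Hz; rewrite !in_app_iff; auto. }
    destruct HF2 as (I1 & I2 & I3 & I4).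
    assert (HC : forall c a, Permutation [e; f; g] [c; a; g'] ->
      (exists x new, proper [x] (map fst new) /\ map fst new = star x [c; a; g'] /\
      forall rest, uses [] [] (F ++ vertices new) rest -> uses [e; f; g] [] F (new ++ rest)) ->
      exists x new, uses [e; f; g] [] F new /\ proper [x] (map fst new) /\
      Permutation (map fst new) (star x [e; f; g])).
    { intros c a HP' (x & new & H1 & H2 & H3). exists x, new. split.
      - rewrite <- (app_nil_r new). apply H3, uses_nil.
      - split; [auto|]. rewrite H2. unfold star. apply Permutation_map. symmetry. exact HP'. }
    apply (Permutation_in _ HP) in Hq. simpl in Hq. destruct Hq as [<-|[<-|[<-|[]]]]; [| |tauto].
    - apply (HC e f' HP). eapply (tripod_then ND HD HP HL1 HL2); auto.
    - assert (HP' : Permutation [e; f; g] [f'; e; g']) by (rewrite HP; constructor).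
      apply (HC f' e HP'). eapply (tripod_then ND HD HP' (link_sym HL1) HL2); auto. }
  inversion ND as [|? ? N1 N2]; subst. inversion N2 as [|? ? N3 N4]; subst. simpl in N1, N3.
  destruct (@linkable_meets_cuts _ F HD (fun i => dec (i = e))) as
      (p & q & Hp & Hq & Pp & Pq & L1 & n1 & m1 & HL1).
  { exists e. split; [simpl; auto|]. apply decT. auto. }
  { exists f. split; [simpl; auto|]. apply decF. intros ->. tauto. }
  rewrite decT in Pp. rewrite decF in Pq. subst p.
  simpl in Hq. destruct Hq as [<-|[<-|[<-|[]]]]; [tauto| |].
  - apply (H f g L1 n1 m1); auto.
  - apply (H g f L1 n1 m1); auto. apply perm_skip. constructor.
Qed.

(** Pairs between [U] and [W] are lifted while links offer them. Once the ray of [f] is reached from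
    both sides, the tripod is built at once, and the rest is matched across the two sides
    afterwards; by [obstructed_matching] every matching is admissible. *)
Lemma realize_obstructed n : forall f U W F, length U = S n -> length W = S n ->
  NoDup (f :: U ++ W) -> (forall i, In i (f :: U ++ W) -> enters i) ->
  exists M u w x new, Permutation U (map fst M ++ [u]) /\ Permutation W (map snd M ++ [w]) /\
    uses (f :: U ++ W) [] F new /\ proper [x] (map fst new) /\
    forall S, cut (map fst new) S = cut (lifts M ++ star x [f; u; w]) S.
Proof.
  induction n as [|n IH]; intros f U W F HU HW ND HD.
  { destruct U as [|u [|]]; try discriminate. destruct W as [|w [|]]; try discriminate.
    destruct (realize_three F ND HD) as (x & new & H1 & H2 & H3).
    exists [], u, w, x, new. repeat (split; [solve [auto]|]). intros S. apply count_perm, H3. }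
  set (D := f :: U ++ W) in *.
  assert (HLift : forall p q L n1 m1, link D F L p n1 q m1 -> In p U -> In q W ->
    exists M u w x new, Permutation U (map fst M ++ [u]) /\ Permutation W (map snd M ++ [w]) /\
    uses D [] F new /\ proper [x] (map fst new) /\
    forall S, cut (map fst new) S = cut (lifts M ++ star x [f; u; w]) S).
  { intros p q L n1 m1 HL Hp Hq.
    destruct (in_perm _ _ Hp) as [U' HU']. destruct (in_perm _ _ Hq) as [W' HW'].
    assert (HP : Permutation D (p :: q :: f :: U' ++ W')).
    { unfold D. rewrite (perm_pair_app HU' HW'). rewrite perm_swap. apply perm_skip, perm_swap. }
    destruct (link_then ND HD HP HL) as (new & H1 & H2 & H3).
    destruct (IH f U' W' (F ++ vertices new)) as (M & u & w & x & rest & M1 & M2 & M3 & M4 & M5).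
    - apply Permutation_length in HU'. simpl in HU'. lia.
    - apply Permutation_length in HW'. simpl in HW'. lia.
    - apply (Permutation_NoDup HP) in ND. inversion ND; subst. inversion H5; subst. auto.
    - intros i Hi. apply HD. apply (Permutation_in _ (Permutation_sym HP)). simpl in *; tauto.
    - exists ((p, q) :: M), u, w, x, (new ++ rest). simpl map.
      split; [rewrite HU'; simpl; auto|]. split; [rewrite HW'; simpl; auto|].
      split; [auto|]. rewrite map_app. split; [apply proper_app; auto|].
      intros S. change (lifts ((p, q) :: M)) with ((t p, t q) :: lifts M).
      rewrite cut_app, H2, M5, !cut_app, !cut_cons. change (cut [] S) with 0. lia. }
  assert (Hd : forall i, In i D -> i <> f -> ~ In i U -> In i W).
  { intros i [->|Hi] Hf Hn; [tauto|]. apply in_app_iff in Hi. tauto. }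
  inversion ND as [|? ? N1 N2]; subst. rewrite in_app_iff in N1.
  assert (HUW : forall i, In i U -> ~ In i W).
  { intros i H1 H2. destruct (in_split _ _ H2) as (W1 & W2 & ->). rewrite app_assoc in N2.
    apply NoDup_remove_2 in N2. rewrite !in_app_iff in N2. tauto. }
  (* With [f] on the side of [U], the link is either a lifting between [U] and [W] or a first leg
     from [f] to [W]. *)
  destruct (@linkable_meets_cuts _ F HD (fun i => dec (i = f \/ In i U))) as
    (p & q & Hp & Hq & Pp & Pq & L1 & n1 & m1 & HL1).
  { exists f. split; [simpl; auto|]. apply decT. auto. }
  { destruct W as [|w W]; [discriminate|]. exists w.
    split; [unfold D; simpl; rewrite in_app_iff; simpl; auto|].
    apply decF. intros [->|H]; [simpl in N1; tauto|]. apply (HUW w H). simpl; auto. }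
  rewrite decT in Pp. rewrite decF in Pq. apply Hd in Hq; [|tauto|tauto].
  destruct Pp as [->|Pp]; [|apply (HLift _ _ _ _ _ HL1); auto].
  (* A second link that also ends on the ray of [f] must miss the first one and end beyond it. If it
     leads from [U] to [W], the first link is discarded. *)
  set (F2 := F ++ L1 ++ initial f n1).
  assert (HF2 : incl F F2 /\ incl L1 F2 /\ incl (initial f n1) F2).
  { unfold F2. repeat split; intros z Hz; rewrite !in_app_iff; auto. }
  destruct HF2 as (I1 & I2 & I3).
  destruct (@linkable_meets_cuts _ F2 HD (fun i => dec (In i U))) as
    (p & q' & Hp' & Hq' & Pp & Pq' & L2 & n2 & m2 & HL2).
  { destruct U as [|u U]; [discriminate|]. exists u. split; [unfold D; simpl; auto|].
    apply decT. simpl; auto. }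
  { exists f. split; [simpl; auto|]. apply decF. tauto. }
  rewrite decT in Pp. rewrite decF in Pq'.
  destruct (classic (q' = f)) as [->|Hne].
  2:{ apply (HLift p q' L2 n2 m2); auto. apply (link_mono (incl_refl D) I1 HL2). }
  destruct (in_perm _ _ Pp) as [U' HU']. destruct (in_perm _ _ Hq) as [W' HW'].
  assert (HP : Permutation D (f :: q :: p :: U' ++ W')).
  { unfold D. rewrite (perm_pair_app HU' HW'). apply perm_skip, perm_swap. }
  apply link_sym in HL2.
  destruct (tripod_then ND HD HP HL1 HL2) as (x & new & T1 & T2 & T3); auto.
  destruct (@realize_matching (S n) U' W' (F ++ vertices new)) as (M & rest & M1 & M2 & M3 & M4 & M5).
  - apply Permutation_length in HU'. simpl in HU'. lia.
  - apply Permutation_length in HW'. simpl in HW'. lia.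
  - apply (Permutation_NoDup HP) in ND. inversion ND as [|? ? _ Q1]; subst.
    inversion Q1 as [|? ? _ Q2]; subst. inversion Q2; subst. auto.
  - intros i Hi. apply HD. apply (Permutation_in _ (Permutation_sym HP)). simpl in *; tauto.
  - exists M, p, q, x.
    pose proof (T3 rest M3) as HU0.
    exists (rest ++ new).
    split; [rewrite HU', M1; apply Permutation_cons_append|].
    split; [rewrite HW', M2; apply Permutation_cons_append|].
    split; [apply (uses_perm HU0), Permutation_app_comm|].
    rewrite map_app. split; [apply proper_app; auto|].
    intros S. rewrite !cut_app, M5, T2. unfold star. simpl map. rewrite !cut_cons. lia.
Qed.

(** The vertex [x] takes over the role of s. In [linked] s lies outside the set, so a set containing
    [x] is treated through its complement. *)
Lemma star_linked c E D x : linked A c E t D -> linked A c (star x D ++ E) t [].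
Proof.
  intros HL S HS. unfold degree. rewrite cut_app, Nat.add_0_r.
  assert (H : cut (star x D) S = count (fun i => xorb (S x) (S (t i))) D).
  { clear. induction D as [|i D IH]; [reflexivity|]. unfold star. simpl map. rewrite cut_cons, count_cons.
    fold (star x D). rewrite IH. reflexivity. }
  rewrite H. destruct (S x).
  - pose proof (HL _ (separates_C HS)) as H1. unfold degree in H1. rewrite cut_C in H1.
    replace (count (fun i => xorb true (S (t i))) D) with (count (fun i => setC S (t i)) D); [lia|].
    apply count_ext_in. reflexivity.
  - pose proof (HL _ HS) as H1. unfold degree in H1.
    replace (count (fun i => xorb false (S (t i))) D) with (count (fun i => S (t i)) D); [lia|].
    apply count_ext_in. intros i _. destruct (S (t i)); reflexivity.
Qed.

(** Induction on the number of edges left at s, with [E] the multigraph and [F] the vertices used so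
    far. At most one vertex arises, since the creation of one ends the process. *)
Lemma realize_component k n : forall D F E, length D <= n -> NoDup D ->
  (forall i, In i D -> enters i) -> linked A (2 * k) E t D ->
  exists xs new, length xs <= 1 /\ uses D [] F new /\ proper xs (map fst new) /\
    linked A (2 * k) (map fst new ++ E) t [].
Proof.
  induction n as [n IH] using lt_wf_ind. intros D F E Hn ND HD HL.
  assert (HDA : forall i, In i D -> In (t i) A) by (intros i Hi; apply HD, Hi).
  assert (HLift : forall p q D', linkable D F p q -> Permutation D (p :: q :: D') ->
    linked A (2 * k) ((t p, t q) :: E) t D' ->
    exists xs new, length xs <= 1 /\ uses D [] F new /\ proper xs (map fst new) /\
    linked A (2 * k) (map fst new ++ E) t []).
  { intros p q D' (L & n1 & m1 & Hlink) HP HL'.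
    destruct (link_then ND HD HP Hlink) as (new & H1 & H2 & H3).
    assert (HN := Permutation_length HP). simpl in HN.
    destruct (IH (length D')) with (D := D') (F := F ++ vertices new) (E := (t p, t q) :: E)
      as (xs & rest & Q1 & Q2 & Q3 & Q4); auto; try lia.
    - apply (Permutation_NoDup HP) in ND. inversion ND; subst. inversion H5; subst. auto.
    - intros i Hi. apply HD. apply (Permutation_in _ (Permutation_sym HP)). simpl; auto.
    - exists xs, (new ++ rest). split; [auto|]. split; [auto|]. rewrite map_app.
      split; [apply proper_app; auto|].
      refine (@linked_cut_ext _ _ _ _ _ _ _ _ _ Q4). intros S.
      rewrite !cut_app, H2, !cut_cons. change (cut [] S) with 0. lia. }
  destruct D as [|i [|j [|l [|o D]]]].
  - exists [], []. split; [simpl; auto|]. split; [apply uses_nil|]. split; [split; intros ? []|]. exact HL.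
  - exists [], []. split; [simpl; auto|]. split; [apply uses_nil|]. split; [split; intros ? []|].
    (* A single edge at s is dropped: [S] or its complement misses its end, and both have the same
       cut in [E]. *)
    intros S HS. pose proof (HL _ HS) as H1. pose proof (HL _ (separates_C HS)) as H2.
    unfold degree in *. rewrite cut_C in H2. rewrite count_cons in H1, H2. unfold setC in H2.
    simpl in *. destruct (S (t i)); unfold count in *; simpl in *; lia.
  - destruct (@linkable_meets_cuts _ F HD (fun x => dec (x = i))) as (p & q & Hp & Hq & Pp & Pq & HT).
    { exists i. split; [simpl; auto|]. apply decT. auto. }
    { exists j. split; [simpl; auto|]. apply decF. intros ->. inversion ND; subst. simpl in *; tauto. }
    rewrite decT in Pp. rewrite decF in Pq. subst p.
    destruct Hq as [<-|[<-|[]]]; [tauto|].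
    (* The last two edges can always be lifted: if [S] contains both ends, its complement has degree
       smaller by 2, which is still at least 2k. *)
    apply (HLift i j []); auto. intros S HS.
    pose proof (degree_lift E t [] i j S) as Hd. pose proof (HL _ HS) as H1.
    pose proof (degree_C E t [i; j] S) as HC. pose proof (HL _ (separates_C HS)) as H2.
    rewrite !count_cons in HC. unfold count in HC. simpl in HC.
    destruct (S (t i)), (S (t j)); simpl in *; lia.
  - destruct (realize_three F ND HD) as (x & new & H1 & H2 & H3).
    exists [x], new. split; [simpl; auto|]. split; [auto|]. split; [auto|].
    refine (@linked_cut_ext _ _ _ _ _ _ _ _ _ (@star_linked _ _ _ x HL)).
    intros S. rewrite !cut_app. f_equal. symmetry. apply count_perm, H3.
  - assert (H4 : 4 <= length (i :: j :: l :: o :: D)) by (simpl; lia).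
    destruct (lift_or_obstructed k HL HDA H4 ND (@linkable_meets_cuts _ F HD))
      as [(p & q & D' & HT & HP & HL')|(f & U & W & HP & HUW & HO)].
    + apply (HLift p q D'); auto.
    + assert (HN := Permutation_length HP). simpl in HN. rewrite length_app in HN.
      destruct U as [|u0 U]; [simpl in *; lia|].
      assert (ND' := Permutation_NoDup HP ND).
      assert (HI : forall i', In i' (f :: (u0 :: U) ++ W) -> enters i').
      { intros i' Hi. apply HD. apply (Permutation_in _ (Permutation_sym HP) Hi). }
      destruct (@realize_obstructed (length U) f (u0 :: U) W F)
        as (M & u & w & x & new & M1 & M2 & M3 & M4 & M5); auto.
      exists [x], new. split; [simpl; auto|].
      split; [revert M3; apply uses_mono; [|apply incl_refl|apply incl_refl];
              intros i'; apply Permutation_in, Permutation_sym, HP|].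
      split; [auto|].
      assert (HP2 : Permutation (f :: (u0 :: U) ++ W)
        (f :: (map fst M ++ [u]) ++ map snd M ++ [w])).
      { apply perm_skip. apply Permutation_app; auto. }
      pose proof (linked_perm (Permutation_trans HP HP2) HL) as HL2.
      apply obstructed_matching in HL2.
      * intros S HS. pose proof (@star_linked _ _ _ x HL2 S HS) as H.
        unfold degree in *. rewrite !cut_app in *. rewrite M5, cut_app. fold (lifts M) in H. lia.
      * intros i' Hi. apply HI. apply (Permutation_in _ (Permutation_sym HP2) Hi).
      * apply (@obstructed_perm _ _ A k t E f _ _ _ _ M1 M2 HO).
Qed.
End Rays.

(** * Components and their boundaries *)

(** One orientation of each edge is listed, since the two orientations would not be
    edge-disjoint. *)
Lemma edge_list {V : Type} (adj : V -> V -> Prop) (adj_sym : forall u v, adj u v -> adj v u)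
  (adj_irrefl : forall v, ~ adj v v) (l : list V) :
  NoDup l -> exists AA,
  (forall e, In e AA -> In (fst e) l /\ In (snd e) l /\ adj (fst e) (snd e)) /\
  (forall u v, In u l -> In v l -> adj u v -> In (u, v) AA \/ In (v, u) AA) /\
  ForallOrdPairs (fun e f => edge_disjoint [fst e; snd e] [fst f; snd f]) AA.
Proof.
  induction 1 as [|a l Ha Hl (AA & H1 & H2 & H3)].
  - exists []. split; [intros ? []|]. split; [intros ? ? []|constructor].
  - exists (map (pair a) (filter (fun x => dec (adj a x)) l) ++ AA).
    assert (Hin : forall e, In e (map (pair a) (filter (fun x => dec (adj a x)) l)) <->
      fst e = a /\ In (snd e) l /\ adj a (snd e)).
    { intros [x y]. rewrite in_map_iff. simpl. split.
      - intros (z & E & Hz). injection E as -> ->. apply filter_In in Hz. rewrite decT in Hz. tauto.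
      - intros (-> & Hy & Hay). exists y. split; [auto|]. apply filter_In. rewrite decT. auto. }
    split; [|split].
    + intros [x y] He. apply in_app_iff in He. destruct He as [He|He].
      * apply Hin in He. simpl in *. destruct He as (-> & ? & ?). auto.
      * destruct (H1 _ He) as (? & ? & ?). simpl in *. auto.
    + intros u v [<-|Hu] [<-|Hv] Huv; rewrite !in_app_iff, !Hin; simpl.
      * destruct (adj_irrefl _ Huv).
      * auto.
      * apply adj_sym in Huv. auto.
      * destruct (H2 u v Hu Hv Huv); auto.
    + apply ForallOrdPairs_app; auto.
      * clear - Hl Ha. induction Hl as [|x l Hx Hl IH]; [constructor|].
        assert (Hax : a <> x) by (intros ->; apply Ha; simpl; auto).
        assert (Hal : ~ In a l) by (simpl in Ha; tauto).
        simpl. destruct (dec (adj a x)); [|auto]. simpl. constructor; [|auto].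
        apply Forall_forall. intros e He. apply in_map_iff in He. destruct He as (y & <- & Hy).
        apply filter_In in Hy. destruct Hy as [Hy _]. assert (x <> y) by (intros ->; auto).
        intros u v; simpl. intros [[[-> ->]|[-> ->]]|[]] [[[? ?]|[? ?]]|[]]; subst; congruence.
      * intros e f He Hf. apply Hin in He. destruct He as (He & _ & _).
        destruct (H1 f Hf) as (Hf1 & Hf2 & _).
        assert (N1 : fst f <> a) by (intros E; rewrite E in Hf1; auto).
        assert (N2 : snd f <> a) by (intros E; rewrite E in Hf2; auto).
        intros u v; simpl. rewrite He.
        intros [[[E _]|[E _]]|[]] [[[E1 E2]|[E1 E2]]|[]]; congruence.
Qed.
Section Graph.
Context {V : Type} (adj : V -> V -> Prop).
Context (adj_sym : forall u v, adj u v -> adj v u) (adj_irrefl : forall v, ~ adj v v).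
Context (A : list V).

Let inner u v := adj u v /\ ~ In u A /\ ~ In v A.

Lemma comp_conn u v : comp adj A u v <-> ~ In u A /\ ~ In v A /\ conn inner u v.
Proof.
  unfold comp. split; intros (H1 & H2 & H3); (do 2 (split; [auto|])).
  - destruct H3 as [p Hp]. apply (gpath_conn Hp).
  - apply (conn_gpath H3).
Qed.

Lemma comp_refl u : ~ In u A -> comp adj A u u.
Proof. intros H. apply comp_conn. split; [auto|]. split; [auto|apply rt_refl]. Qed.

Lemma comp_sym u v : comp adj A u v -> comp adj A v u.
Proof.
  rewrite !comp_conn. intros (H1 & H2 & H3). do 2 (split; [auto|]). apply conn_sym; auto.
  intros x y (? & ? & ?). split; auto.
Qed.

Lemma comp_trans u v w : comp adj A u v -> comp adj A v w -> comp adj A u w.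
Proof.
  rewrite !comp_conn. intros (H1 & H2 & H3) (H4 & H5 & H6). do 2 (split; [auto|]).
  apply rt_trans with v; auto.
Qed.

Lemma comp_adj c u v : comp adj A c u -> adj u v -> ~ In v A -> comp adj A c v.
Proof.
  intros H Huv Hv. apply comp_trans with u; [auto|]. apply comp_conn. destruct H as (_ & Hu & _).
  do 2 (split; [auto|]). apply rt_step. split; auto.
Qed.

Lemma comp_out c v : comp adj A c v -> ~ In v A.
Proof. intros (_ & H & _). exact H. Qed.

(** This makes the number of components finite: each contains a neighbour of the finite set [A], and
    neighbourhoods are finite. *)
Lemma comp_neighbour u a :
  conn adj u a -> ~ In u A -> In a A -> exists v b, comp adj A u v /\ adj v b /\ In b A.
Proof.
  intros H. apply clos_rt_rt1n in H. induction H as [u|u y a Huy _ IH]; intros Hu Ha; [tauto|].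
  destruct (classic (In y A)) as [Hy|Hy].
  - exists u, y. split; [apply comp_refl|]; auto.
  - destruct (IH Hy Ha) as (v & b & H1 & H2 & H3). exists v, b. split; [|auto].
    apply comp_trans with y; [|auto]. apply comp_adj with u; auto. apply comp_refl; auto.
Qed.

Definition representatives (reps : list V) : Prop :=
  NoDup reps /\ (forall c, In c reps -> ~ In c A) /\
  (forall c d, In c reps -> In d reps -> comp adj A c d -> c = d).

Lemma representatives_exist (N : list V) :
  exists reps, representatives reps /\
    forall c, In c N -> ~ In c A -> exists d, In d reps /\ comp adj A d c.
Proof.
  induction N as [|c N (reps & (H1 & H2 & H3) & H4)].
  - exists []. split; [split; [constructor|split; [intros ? []|intros ? ? []]]|intros ? []].
  - destruct (classic (~ In c A /\ forall d, In d reps -> ~ comp adj A d c)) as [[Hc Hd]|Hn].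
    + exists (c :: reps). split; [split; [|split]|].
      * constructor; [|auto]. intros Hin. apply (Hd c Hin), comp_refl, Hc.
      * intros d [<-|Hin]; auto.
      * intros d e [<-|Hin] [<-|Hin'] Hde; auto; exfalso.
        -- apply (Hd e Hin'). apply comp_sym, Hde.
        -- apply (Hd d Hin Hde).
      * intros d [<-|Hin] Hda.
        -- exists c. split; [simpl; auto|apply comp_refl, Hc].
        -- destruct (H4 d Hin Hda) as (e & He & Hed). exists e. simpl; auto.
    + exists reps. split; [repeat split; auto|]. intros d [<-|Hin] Hda; [|auto].
      apply NNPP. intros HE. apply Hn. split; [auto|]. intros d Hd Hdc. apply HE. eauto.
Qed.

Context (nb : V -> list V) (nb_adj : forall v w, adj v w -> In w (nb v)).

(* [bd] lists the boundary edges of the component of [c], outer end first; they are the first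
   edges of a family of rays as in the definition of boundary-linked. *)
Definition ray_system (c : V) (bd : list (V * V)) : Prop :=
  exists (I : Type) (R : I -> nat -> V) (D : list I),
    (forall i, ray adj (R i)) /\
    (forall i j, i <> j -> rays_edge_disjoint (R i) (R j)) /\
    (forall i j, i <> j -> equiv_rays adj (R i) (R j)) /\
    NoDup D /\ (forall i, In i D -> enters A (comp adj A c) R i) /\
    bd = map (fun i => (R i 0, R i 1)) D /\
    forall u v, boundary_edge adj (comp adj A c) u v -> In (v, u) bd.

Lemma list_choice {T U} (l : list T) (Q : T -> U -> Prop) :
  (forall x, In x l -> exists i, Q x i) ->
  exists D, (forall i, In i D -> exists x, In x l /\ Q x i) /\
    forall x, In x l -> exists i, In i D /\ Q x i.
Proof.
  induction l as [|x l IH]; intros H.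
  - exists []. split; intros ? [].
  - destruct IH as (D & H1 & H2); [intros; apply H; simpl; auto|].
    destruct (H x) as [i Hi]; [simpl; auto|]. exists (i :: D). split.
    + intros j [<-|Hj]; [exists x; simpl; auto|]. destruct (H1 j Hj) as (y & ? & ?).
      exists y; simpl; auto.
    + intros y [<-|Hy]; [exists i; simpl; auto|]. destruct (H2 y Hy) as (j & ? & ?).
      exists j; simpl; auto.
Qed.

(** By local finiteness there are finitely many boundary edges, and a ray is chosen for each. Such a
    ray stays in the component after its first edge, because it cannot use a second boundary
    edge. *)
Lemma ray_system_exists c : boundary_linked adj (comp adj A c) -> exists bd, ray_system c bd.
Proof.
  set (B := comp adj A c). intros (I & R & HR & Hdisj & Hequiv & Hbd).
  assert (Hout : forall u v, boundary_edge adj B u v -> In v A).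
  { intros u v (Huv & Bu & Bv). apply NNPP. intros Hv. apply Bv. apply (comp_adj Bu Huv Hv). }
  set (BE := flat_map (fun v => map (fun u => (u, v))
    (filter (fun u => dec (boundary_edge adj B u v)) (nb v))) A).
  assert (HBE : forall u v, In (u, v) BE <-> boundary_edge adj B u v).
  { intros u v. unfold BE. rewrite in_flat_map. split.
    - intros (w & Hw & H). apply in_map_iff in H. destruct H as (x & E & H). injection E as -> ->.
      apply filter_In in H. destruct H as [_ H]. rewrite decT in H. auto.
    - intros H. exists v. split; [apply (Hout _ _ H)|]. apply in_map_iff. exists u. split; [auto|].
      apply filter_In. split; [apply nb_adj, adj_sym, H|]. rewrite decT. auto. }
  destruct (list_choice BE (fun e i => redge (R i) 0 (fst e) (snd e))) as (D & HD1 & HD2).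
  { intros [u v] H. apply HBE in H. apply (Hbd u v H). }
  assert (Ieq : forall i j : I, {i = j} + {i <> j}) by (intros; apply excluded_middle_informative).
  assert (Hent : forall i, In i D -> enters A B R i /\
    forall u v, redge (R i) 0 u v -> B u -> ~ B v -> R i 0 = v /\ R i 1 = u).
  { intros i Hi. destruct (HR i) as [[Hinj Hadj] HB].
    (* Every boundary edge is the first edge of some ray, so by edge-disjointness it occurs nowhere
       else. *)
    assert (Hpos : forall n u v, redge (R i) n u v -> boundary_edge adj B u v -> n = 0).
    { intros n u v Hr Hb. destruct (Hbd u v Hb) as [j Hj].
      destruct (classic (i = j)) as [<-|Hij].
      - apply (@redge_inj _ _ adj R (fun i => proj1 (HR i)) i n 0 u v Hr Hj).
      - destruct (Hdisj i j Hij _ _ _ _ Hr Hj). }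
    assert (HS : forall n, B (R i (S n))).
    { assert (Hstep : forall n, B (R i (S n)) <-> B (R i (S (S n)))).
      { intros n. split; intros H1; apply NNPP; intros H2.
        - assert (S n = 0); [|lia]. apply (Hpos (S n) (R i (S n)) (R i (S (S n)))).
          + left; auto.
          + split; auto.
        - assert (S n = 0); [|lia]. apply (Hpos (S n) (R i (S (S n))) (R i (S n))).
          + right; auto.
          + split; auto. }
      induction n as [|n IH]; [|apply (Hstep n), IH].
      destruct (HB 1) as [H|H]; [auto|]. apply (Hstep 0), H. }
    assert (Hor : forall u v, redge (R i) 0 u v -> B u -> ~ B v -> R i 0 = v /\ R i 1 = u).
    { intros u v [[H1 H2]|[H1 H2]] Bu Bv; [|auto]. exfalso. apply Bv. rewrite <- H2. apply HS. }
    split; [split|]; auto.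
    destruct (HD1 i Hi) as ([u v] & Huv & Hr). simpl in Hr. apply HBE in Huv.
    destruct (Hor u v Hr) as [-> _]; [apply Huv|apply Huv|]. apply (Hout _ _ Huv). }
  exists (map (fun i => (R i 0, R i 1)) (nodup Ieq D)). exists I, R, (nodup Ieq D).
  split; [apply HR|]. do 2 (split; [auto|]). split; [apply NoDup_nodup|].
  split; [intros i Hi; apply nodup_In in Hi; apply Hent, Hi|]. split; [auto|].
  intros u v Huv. destruct (HD2 (u, v)) as (i & Hi & Hr); [apply HBE, Huv|]. simpl in Hr.
  apply in_map_iff. exists i. split; [|apply nodup_In, Hi].
  destruct (Hent i Hi) as [_ Ho]. destruct (Ho u v Hr) as [-> ->]; auto; apply Huv.
Qed.

Definition spokes (bd : V -> list (V * V)) (c : V) : list (V * V) :=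
  map (fun e => (c, fst e)) (bd c).

Lemma conn_cross (P : V -> V -> Prop) (S : V -> bool) u v :
  conn P u v -> S u = true -> S v = false -> exists x y, P x y /\ S x = true /\ S y = false.
Proof.
  intros H. apply clos_rt_rt1n in H. induction H as [u|u y v Huy _ IH]; intros Hu Hv; [congruence|].
  destruct (S y) eqn:Hy; eauto.
Qed.

(* The multigraph obtained from G by contracting each component of G - A to its representative
   inherits the edge-connectivity of G. *)
Lemma contraction_cut l AA bd reps :
  edge_connected adj l -> representatives reps ->
  (forall v, ~ In v A -> exists c, In c reps /\ comp adj A c v) ->
  (forall u v, In u A -> In v A -> adj u v -> In (u, v) AA \/ In (v, u) AA) ->
  (forall c, In c reps -> forall u v, boundary_edge adj (comp adj A c) u v -> In (v, u) (bd c)) ->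
  forall S, separates A S -> l <= cut (AA ++ flat_map (spokes bd) reps) S.
Proof.
  intros Hconn (R1 & R2 & R3) Hcov HAA Hbd S ((a & Aa & Sa) & (b & Ab & Sb)).
  (* The contraction maps [v] to [c], and [S'] is the preimage of [S] in G. *)
  set (side := fun v c => In v A /\ c = v \/ In c reps /\ comp adj A c v).
  set (S' := fun v => dec (exists c, side v c /\ S c = true)).
  assert (Huniq : forall v c d, side v c -> side v d -> c = d).
  { intros v c d [[H1 ->]|[H1 H2]] [[H3 ->]|[H3 H4]]; auto.
    - destruct (comp_out H4 H1).
    - destruct (comp_out H2 H3).
    - apply R3; auto. apply comp_trans with v; [auto|apply comp_sym; auto]. }
  assert (HS' : forall v c, side v c -> S' v = S c).
  { intros v c Hc. unfold S'. destruct (S c) eqn:E.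
    - apply decT. eauto.
    - apply decF. intros (d & Hd & Sd). rewrite (Huniq v c d Hc Hd) in E. congruence. }
  assert (Hside : forall v, exists c, side v c).
  { intros v. destruct (classic (In v A)) as [H|H]; [exists v; left; auto|].
    destruct (Hcov v H) as (c & ? & ?). exists c. right; auto. }
  (* The edges of G behind the edges of the contraction across [S]. If they were fewer than [l], a
     path avoiding them would still have to cross [S']. *)
  set (F := filter (fun e => xorb (S (fst e)) (S (snd e))) AA ++
    flat_map (fun c => filter (fun e => xorb (S c) (S (fst e))) (bd c)) reps).
  assert (HF : length F = cut (AA ++ flat_map (spokes bd) reps) S).
  { unfold F. rewrite length_app, cut_app. f_equal.
    clear. induction reps as [|c reps IH]; [reflexivity|]. simpl flat_map.
    rewrite length_app, cut_app, IH. f_equal. unfold spokes.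
    induction (bd c) as [|e l IH']; [reflexivity|]. simpl map. rewrite cut_cons. simpl filter.
    destruct (xorb (S c) (S (fst e))); simpl; rewrite IH'; reflexivity. }
  apply Nat.nlt_ge. intros Hlt. rewrite <- HF in Hlt.
  destruct (Hconn F Hlt a b) as [p Hp]. apply gpath_conn in Hp.
  destruct (conn_cross S' Hp) as (x & y & [Hxy [N1 N2]] & Sx & Sy).
  { rewrite (HS' a a); [auto|left; auto]. }
  { rewrite (HS' b b); [auto|left; auto]. }
  destruct (Hside x) as [c Hc]. destruct (Hside y) as [d Hd].
  rewrite (HS' x c Hc) in Sx. rewrite (HS' y d Hd) in Sy.
  assert (Hstar : forall u v e, In e reps -> comp adj A e u -> In v A -> adj u v ->
    xorb (S e) (S v) = true -> In (v, u) F).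
  { intros u v e He Hu Hv Huv HX. unfold F. apply in_app_iff. right. apply in_flat_map.
    exists e. split; [auto|]. apply filter_In. split; [|auto]. apply Hbd; auto.
    split; [auto|]. split; [auto|]. intros HE. apply (comp_out HE Hv). }
  destruct Hc as [[Ax ->]|[Rc Cx]], Hd as [[Ay ->]|[Rd Cy]].
  - destruct (HAA x y Ax Ay Hxy) as [H|H].
    + apply N1. unfold F. apply in_app_iff. left. apply filter_In. split; [auto|].
      simpl. rewrite Sx, Sy. reflexivity.
    + apply N2. unfold F. apply in_app_iff. left. apply filter_In. split; [auto|].
      simpl. rewrite Sx, Sy. reflexivity.
  - apply N1. apply (Hstar y x d); auto. rewrite Sx, Sy. reflexivity.
  - apply N2. apply (Hstar x y c); auto. rewrite Sx, Sy. reflexivity.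
  - assert (c = d); [|congruence]. apply (Huniq y); right; [|auto]. split; [auto|].
    apply (comp_adj Cx Hxy). apply (comp_out Cy).
Qed.
End Graph.

(** * Assembling the immersion from the components *)

Lemma realize_representative (V : Type) (adj : V -> V -> Prop)
  (adj_sym : forall u v, adj u v -> adj v u) (adj_irrefl : forall v, ~ adj v v)
  (A : list V) (k : nat) (c : V) (bd : V -> list (V * V)) (E : list (V * V)) :
  ~ In c A -> ray_system adj A c (bd c) ->
  (forall e, In e E -> fst e <> c /\ snd e <> c) ->
  (forall S, separates A S -> 2 * k <= cut (spokes bd c ++ E) S) ->
  exists xs imm, length xs <= 1 /\ immersion adj imm /\
    (forall e, In e imm -> forall u v, pedge (snd e) u v -> comp adj A c u \/ comp adj A c v) /\
    proper A (comp adj A c) xs (map fst imm) /\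
    forall S, separates A S -> 2 * k <= cut (map fst imm ++ E) S.
Proof.
  intros Hc (I & R & D & HR & Hdisj & Hequiv & ND & Hent & Hbd & _) HE Hcut.
  destruct (@realize_component V I adj adj_sym adj_irrefl A (comp adj A c) R) with
    (k := k) (n := length D) (D := D) (F := @nil V) (E := E) as (xs & imm & H1 & H2 & H3 & H4); auto.
  - apply comp_out.
  - intros u v Hu Huv Hv. apply (comp_adj _ Hu Huv Hv).
  (* The contracted vertex [c] becomes s, which [degree] places outside the set; so [c] is removed
     from [S]. *)
  - intros S HS. set (S0 := fun v => if dec (v = c) then false else S v).
    assert (HS0 : forall v, v <> c -> S0 v = S v).
    { intros v Hv. unfold S0. rewrite (proj2 (decF _) Hv). reflexivity. }
    assert (HA : forall v, In v A -> v <> c) by (intros v Hv ->; auto).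
    assert (HSep : separates A S0).
    { destruct HS as ((a & Aa & Sa) & (b & Ab & Sb)).
      split; [exists a | exists b]; rewrite HS0 by auto; auto. }
    pose proof (Hcut S0 HSep) as HC. rewrite cut_app in HC. unfold degree.
    replace (cut E S0) with (cut E S) in HC.
    + replace (cut (spokes bd c) S0) with (count (fun i => S (R i 0)) D) in HC; [lia|].
      unfold spokes. rewrite Hbd. clear - HS0 HA Hent.
      assert (Sc : S0 c = false) by (unfold S0; rewrite (proj2 (decT _) eq_refl); reflexivity).
      induction D as [|i D IH]; [reflexivity|]. simpl map. rewrite cut_cons, count_cons, Sc.
      rewrite IH by (intros; apply Hent; simpl; auto). simpl. rewrite HS0; [destruct (S (R i 0)); auto|].
      apply HA, Hent. simpl; auto.
    + apply count_ext_in. intros e He. destruct (HE e He). rewrite !HS0; auto.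
  - exists xs, imm. split; [auto|]. destruct H2 as [H2 H2']. split; [auto|]. split.
    + intros e He u v Huv. apply (H2' e He u v Huv).
    + split; [auto|]. intros S HS. pose proof (H4 S HS) as H. unfold degree in H.
      change (count _ []) with 0 in H. lia.
Qed.

(** [E] collects the edges within [A] and those created for components already treated; the others
    are still present as contracted vertices with their spokes. *)
Lemma realize_representatives (V : Type) (adj : V -> V -> Prop)
  (adj_sym : forall u v, adj u v -> adj v u) (adj_irrefl : forall v, ~ adj v v)
  (A : list V) (k : nat) (bd : V -> list (V * V)) (reps : list V) : forall E,
  representatives adj A reps -> (forall c, In c reps -> ray_system adj A c (bd c)) ->
  (forall e c, In e E -> In c reps -> fst e <> c /\ snd e <> c) ->
  (forall S, separates A S -> 2 * k <= cut (E ++ flat_map (spokes bd) reps) S) ->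
  exists X imm, NoDup X /\ (forall x, In x X -> exists c, In c reps /\ comp adj A c x) /\
    (forall x y, In x X -> In y X -> comp adj A x y -> x = y) /\ immersion adj imm /\
    (forall e, In e imm -> forall u v, pedge (snd e) u v ->
      exists c, In c reps /\ (comp adj A c u \/ comp adj A c v)) /\
    proper A (fun v => ~ In v A) X (map fst imm) /\
    forall S, separates A S -> 2 * k <= cut (map fst imm ++ E) S.
Proof.
  induction reps as [|c reps IH]; intros E HR Hray HE Hcut.
  { exists [], []. split; [constructor|]. split; [intros ? []|]. split; [intros ? ? []|].
    split; [split; constructor|]. split; [intros ? []|]. split; [split; intros ? []|].
    intros S HS. pose proof (Hcut S HS) as H. simpl in H. rewrite app_nil_r in H. exact H. }
  destruct HR as (R1 & R2 & R3). inversion R1 as [|? ? Nc R1']; subst.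
  assert (Hc : ~ In c A) by (apply R2; simpl; auto).
  assert (HcA : forall a d, In a A -> In d (c :: reps) -> a <> d).
  { intros a d Ha Hd ->. exact (R2 d Hd Ha). }
  assert (Hbd : forall d e, In d (c :: reps) -> In e (bd d) -> In (fst e) A).
  { intros d e Hd He. destruct (Hray d Hd) as (I & R & D & _ & _ & _ & _ & Hent & Hb & _).
    rewrite Hb in He. apply in_map_iff in He. destruct He as (i & <- & Hi). apply Hent, Hi. }
  destruct (@realize_representative V adj adj_sym adj_irrefl A k c bd (E ++ flat_map (spokes bd) reps))
    as (xs & new & N1 & N2 & N3 & [N4 N5] & N6); auto.
  { apply Hray; simpl; auto. }
  { intros e He. apply in_app_iff in He. destruct He as [He|He]; [apply HE; simpl; auto|].
    apply in_flat_map in He. destruct He as (d & Hd & He). apply in_map_iff in He.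
    destruct He as (f & <- & Hf). simpl. split; [intros ->; auto|].
    apply HcA; [apply (Hbd d f)|]; simpl; auto. }
  { intros S HS. pose proof (Hcut S HS) as H. simpl in H. rewrite !cut_app in *. lia. }
  destruct (IH (map fst new ++ E)) as (X & imm & I1 & I2 & I3 & I4 & I5 & [I6 I7] & I8).
  { split; [auto|]. split; [intros; apply R2; simpl; auto|].
    intros d e Hd He. apply R3; simpl; auto. }
  { intros d Hd. apply Hray; simpl; auto. }
  { intros e d He Hd. apply in_app_iff in He. destruct He as [He|He]; [|apply HE; simpl; auto].
    destruct (N4 e He) as (H1 & H2 & _).
    assert (HA : forall a, In a A -> a <> d) by (intros a Ha; apply HcA; simpl; auto).
    split; [|auto]. destruct H1 as [H1|H1]; [auto|]. intros E1. destruct (N5 _ H1) as [H3 _].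
    rewrite E1 in H3. apply Nc. rewrite (R3 c d); simpl; auto. }
  { intros S HS. pose proof (N6 S HS) as H. rewrite !cut_app in *. lia. }
  assert (Hsep : forall x d, comp adj A c x -> In d reps -> ~ comp adj A d x).
  { intros x d H1 Hd H2. apply Nc. rewrite (R3 c d); simpl; auto.
    apply comp_trans with x; [auto|]. apply (comp_sym adj_sym); auto. }
  assert (Hxs : forall x, In x xs -> comp adj A c x) by (intros x Hx; apply N5, Hx).
  exists (xs ++ X), (new ++ imm). repeat split.
  - destruct xs as [|x [|]]; [auto| |simpl in N1; lia]. simpl. constructor; [|auto].
    intros Hx. destruct (I2 x Hx) as (d & Hd & Hdx). apply (@Hsep x d); auto. apply Hxs; simpl; auto.
  - intros x Hx. apply in_app_iff in Hx. destruct Hx as [Hx|Hx].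
    + exists c. simpl. auto.
    + destruct (I2 x Hx) as (d & ? & ?). exists d. simpl. auto.
  - intros x y Hx Hy Hxy. apply in_app_iff in Hx, Hy. destruct Hx as [Hx|Hx], Hy as [Hy|Hy].
    + destruct xs as [|z [|]]; [destruct Hx| |simpl in N1; lia].
      destruct Hx as [<-|[]], Hy as [<-|[]]. auto.
    + exfalso. destruct (I2 y Hy) as (d & Hd & Hdy). apply (@Hsep y d); auto.
      apply comp_trans with x; auto.
    + exfalso. destruct (I2 x Hx) as (d & Hd & Hdx). apply (@Hsep y d); auto.
      apply comp_trans with x; auto.
    + apply I3; auto.
  - destruct N2, I4. apply Forall_app. auto.
  - destruct N2 as [N2 N2'], I4. apply ForallOrdPairs_app; auto.
    intros e f He Hf u v Hu Hv.
    assert (Huv : adj u v).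
    { rewrite Forall_forall in N2. destruct (N2 e He) as (_ & _ & Hw & _).
      destruct (@gwalk_pedge V adj (snd e) u v Hw Hu); auto. }
    destruct (I5 f Hf u v Hv) as (d & Hd & Hduv).
    (* An edge used for two components would have an end in each, but adjacent vertices outside [A]
       share a component. *)
    assert (HX : forall x y, adj x y -> comp adj A c x -> (comp adj A d x \/ comp adj A d y) -> False).
    { intros x y Hxy Hx [Hdx|Hdy]; [apply (@Hsep x d); auto|]. apply (@Hsep y d); auto.
      apply (comp_adj _ Hx Hxy). apply (comp_out Hdy). }
    destruct (N3 e He u v Hu) as [H1|H1]; [apply (HX u v)|apply (HX v u)]; auto; tauto.
  - intros e He u v Huv. apply in_app_iff in He. destruct He as [He|He].
    + exists c. split; [simpl; auto|]. apply (N3 e He u v Huv).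
    + destruct (I5 e He u v Huv) as (d & Hd & H). exists d. simpl. auto.
  - rewrite map_app, in_app_iff in H. rewrite in_app_iff. destruct H as [He|He].
    + destruct (N4 e He) as ([?|?] & _); auto.
    + destruct (I6 e He) as ([?|?] & _); auto.
  - rewrite map_app, in_app_iff in H. destruct H as [He|He]; [apply N4|apply I6]; auto.
  - rewrite map_app, in_app_iff in H. destruct H as [He|He]; [apply N4|apply I6]; auto.
  - apply in_app_iff in H. destruct H as [H|H].
    + apply (comp_out (Hxs x H)).
    + apply (I7 x H).
  - rewrite map_app. apply in_app_iff in H. destruct H as [Hx|Hx].
    + change 3 with (3 + 0). apply degH_app; [apply N5, Hx|]. apply degH_none. intros e He.
      pose proof (comp_out (Hxs x Hx)) as HxA. destruct (I6 e He) as (H1 & H2 & _).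
      split; [|intros E1; rewrite E1 in H2; auto]. intros E1. rewrite E1 in H1.
      destruct H1 as [H1|H1]; [auto|]. destruct (I2 x H1) as (d & Hd & Hdx).
      apply (@Hsep x d); auto.
    + change 3 with (0 + 3). apply degH_app; [|apply I7, Hx]. apply degH_none. intros e He.
      destruct (I2 x Hx) as (d & Hd & Hdx). pose proof (comp_out Hdx) as HxA.
      destruct (N4 e He) as (H1 & H2 & _).
      split; [|intros E1; rewrite E1 in H2; auto]. intros E1. rewrite E1 in H1.
      destruct H1 as [H1|H1]; [auto|]. apply (@Hsep x d); auto.
  - intros S HS. pose proof (I8 S HS) as H. rewrite map_app, !cut_app in *. lia.
Qed.

Theorem theorem3p2 (V : Type) (adj : V -> V -> Prop)
  (adj_sym : forall u v, adj u v -> adj v u)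
  (adj_irrefl : forall v, ~ adj v v)
  (k : nat) (hk : 2 <= k)
  (hlf : locally_finite adj)
  (hconn : edge_connected adj (2 * k))
  (A : list V)
  (hA : forall v, ~ In v A -> boundary_linked adj (comp adj A v)) :
  exists (X : list V) (imm : list ((V * V) * list V)),
    NoDup X /\
    (forall x, In x X -> ~ In x A) /\
    (forall x y, In x X -> In y X -> comp adj A x y -> x = y) /\
    immersion adj imm /\
    Forall (fun e => In (fst e) (A ++ X) /\ In (snd e) (A ++ X) /\ fst e <> snd e)
      (map fst imm) /\
    h_edge_connected (map fst imm) (A ++ X) 3 /\
    (forall x, In x X -> degH x (map fst imm) 3) /\
    (forall a b, In a A -> In b A -> a <> b -> lambda_ge (map fst imm) a b (2 * k)) /\
    (forall u v, In u A -> In v A -> adj u v ->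
       In ((u, v), [u; v]) imm \/ In ((v, u), [v; u]) imm).
Proof.
  destruct (classic (A = [])) as [->|HA0].
  (* If [A] is empty, the multigraph without vertices will do. *)
  { exists [], []. split; [constructor|]. do 2 (split; [intros; contradiction|]).
    split; [split; constructor|]. split; [constructor|]. split; [intros F _ u v []|].
    split; [intros x []|]. split; [intros a b []|]. intros u v []. }
  set (nb := fun v => proj1_sig (constructive_indefinite_description _ (hlf v))).
  assert (nb_adj : forall v w, adj v w -> In w (nb v)).
  { intros v. exact (proj2_sig (constructive_indefinite_description _ (hlf v))). }
  destruct (representatives_exist adj adj_sym A (flat_map nb A)) as (reps & HR & Hcov0).
  assert (Hcov : forall v, ~ In v A -> exists c, In c reps /\ comp adj A c v).
  { intros v Hv. destruct A as [|a A']; [congruence|]. set (A := a :: A') in *.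
    destruct (hconn []) with (u := v) (v := a) as [p Hp]; [simpl; lia|].
    apply gpath_conn in Hp.
    destruct (@comp_neighbour V adj A v a) as (w & b & H1 & H2 & H3); auto.
    { revert Hp. apply conn_mono. intros x y [H _]. exact H. }
    { unfold A. simpl; auto. }
    destruct (Hcov0 w) as (c & Hc & Hcw).
    - apply in_flat_map. exists b. auto.
    - apply (comp_out H1).
    - exists c. split; [auto|]. apply comp_trans with w; [auto|]. apply (comp_sym adj_sym); auto. }
  assert (HA' : forall c, exists bd, In c reps -> ray_system adj A c bd).
  { intros c. destruct (classic (In c reps)) as [Hc|Hc]; [|exists []; tauto].
    destruct HR as (_ & R2 & _).
    destruct (ray_system_exists adj_sym nb nb_adj (hA c (R2 c Hc))) as [bd Hbd]. eauto. }
  set (bd := fun c => proj1_sig (constructive_indefinite_description _ (HA' c))).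
  assert (Hbd : forall c, In c reps -> ray_system adj A c (bd c)).
  { intros c. exact (proj2_sig (constructive_indefinite_description _ (HA' c))). }
  assert (Veq : forall x y : V, {x = y} + {x <> y}) by (intros; apply excluded_middle_informative).
  (* The edges within [A] are their own paths and are never lifted, which gives (iii). *)
  destruct (@edge_list V adj adj_sym adj_irrefl (nodup Veq A) (NoDup_nodup Veq A))
    as (AA & A1 & A2 & A3).
  assert (A1' : forall e, In e AA -> In (fst e) A /\ In (snd e) A /\ adj (fst e) (snd e)).
  { intros e He. destruct (A1 e He) as (H1 & H2 & H3). rewrite nodup_In in H1, H2. auto. }
  destruct (@realize_representatives V adj adj_sym adj_irrefl A k bd reps AA)
    as (X & imm & X1 & X2 & X3 & [X4 X5] & X6 & [X7 X8] & X9); auto.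
  { intros e c He Hc. destruct (A1' e He) as (H1 & H2 & _). destruct HR as (_ & R2 & _).
    split; intros E; [rewrite E in H1|rewrite E in H2]; apply (R2 c Hc); auto. }
  { apply (contraction_cut adj_sym AA bd hconn HR Hcov).
    - intros u v Hu Hv. apply A2; rewrite nodup_In; auto.
    - intros c Hc. destruct (Hbd c Hc) as (I & R & D & _ & _ & _ & _ & _ & _ & H). exact H. }
  set (immA := map (fun e : V * V => (e, [fst e; snd e])) AA).
  assert (EA : map fst immA = AA) by (unfold immA; rewrite map_map; apply map_id).
  set (H := map fst (immA ++ imm)).
  assert (Hcut : forall S, separates A S -> 2 * k <= cut H S).
  { intros S HS. unfold H. rewrite map_app, EA, cut_app. specialize (X9 S HS).
    rewrite cut_app in X9. lia. }
  assert (Hends : forall e, In e H ->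
    (In (fst e) A \/ In (fst e) X) /\ In (snd e) A /\ fst e <> snd e).
  { intros e He. unfold H in He. rewrite map_app, EA in He. apply in_app_iff in He.
    destruct He as [He|He]; [|apply X7, He]. destruct (A1' e He) as (H1 & H2 & H3).
    split; [auto|]. split; [auto|]. intros E. rewrite E in H3. exact (adj_irrefl _ H3). }
  assert (Hdeg : forall x, In x X -> degH x H 3).
  { intros x Hx. destruct (X8 x Hx) as [HxA Hd]. unfold H. rewrite map_app, EA. change 3 with (0 + 3).
    apply degH_app; [|auto]. apply degH_none. intros e He. destruct (A1' e He) as (H1 & H2 & _).
    split; intros E; [rewrite E in H1|rewrite E in H2]; auto. }
  assert (HX3 : forall x (S : V -> bool), In x X -> (forall a, In a A -> xorb (S x) (S a) = true) ->
    3 <= cut H S).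
  { intros x S Hx HS. apply (degH_cut S (Hdeg x Hx)). intros e He Hxe.
    destruct (Hends e He) as (_ & H2 & _).
    destruct Hxe as [->|Hxe]; [apply HS, H2|].
    rewrite Hxe in H2. destruct (X8 x Hx); contradiction. }
  exists X, (immA ++ imm). fold H.
  split; [auto|]. split; [intros x Hx; apply X8, Hx|]. split; [auto|]. split; [split|].
  - apply Forall_app. split; [|auto]. apply Forall_forall. intros p Hp.
    apply in_map_iff in Hp. destruct Hp as (e & <- & He). destruct (A1' e He) as (_ & _ & He').
    simpl. apply gpath_cons with (y := snd e); [auto|apply gpath_nil|].
    intros [E|[]]. rewrite E in He'. exact (adj_irrefl _ He').
  - apply ForallOrdPairs_app; auto.
    + unfold immA. clear - A3. induction A3 as [|e l He Hl IH]; [constructor|]. simpl.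
      constructor; [|auto]. rewrite Forall_forall in *. intros p Hp. apply in_map_iff in Hp.
      destruct Hp as (f & <- & Hf). apply (He f Hf).
    (* Every edge of the other paths has an end outside [A]. *)
    + intros p q Hp Hq u v Hu Hv. apply in_map_iff in Hp. destruct Hp as (e & <- & He).
      destruct (A1' e He) as (H1 & H2 & _). destruct (X6 q Hq u v Hv) as (c & _ & Hc).
      simpl in Hu. destruct Hu as [[[<- <-]|[<- <-]]|[]];
        destruct Hc as [Hc|Hc]; apply (comp_out Hc); auto.
  - split; [|split; [|split; [auto|split]]].
    + apply Forall_forall. intros e He. rewrite !in_app_iff. destruct (Hends e He). tauto.
    + intros F HF u v Hu Hv. apply (h_connected_of_cuts _ (u, u)). intros S Su Sv.
      apply Nat.lt_le_trans with 3; [auto|].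
      destruct (classic (exists a, In a A /\ S a = true)) as [HT|HT].
      * destruct (classic (exists b, In b A /\ S b = false)) as [HF'|HF'].
        { apply Nat.le_trans with (2 * k); [lia|]. apply Hcut. split; auto. }
        apply (HX3 v).
        -- apply in_app_iff in Hv. destruct Hv as [Hv|Hv]; [exfalso; eauto|auto].
        -- intros a Ha. rewrite Sv. destruct (S a) eqn:Sa; [auto|exfalso; eauto].
      * apply (HX3 u).
        -- apply in_app_iff in Hu. destruct Hu as [Hu|Hu]; [exfalso; eauto|auto].
        -- intros a Ha. rewrite Su. destruct (S a) eqn:Sa; [exfalso; eauto|auto].
    + intros a b Ha Hb _. apply (menger _ (a, a)). intros S Sa Sb. apply Hcut. split; eauto.
    + intros u v Hu Hv Huv. destruct (A2 u v) as [Huv'|Huv']; auto; try (rewrite nodup_In; auto);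
        [left|right]; apply in_app_iff; left; apply in_map_iff; eexists; split; eauto; reflexivity.
Qed.
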